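(* Let $A$ be a commutative arithmetical ring. The following conditions are equivalent: (1) $A$ has Krull dimension; (2) every factor ring of $A$ is finite-dimensional and does not have idempotent proper essential ideals.
   Context: All rings are associative with non-zero identity element; all modules are unitary right modules. A ring is arithmetical if its lattice of two-sided ideals is distributive. A module $M$ is finite-dimensional if it does not contain a direct sum of an infinite number of non-zero submodules; a commutative ring $R$ is finite-dimensional if the module $R_R$ is. A submodule $X$ of a module $M$ is essential if $X\cap Y\neq 0$ for every non-zero submodule $Y$ of $M$; an ideal of a commutative ring $R$ is essential if it is an essential submodule of $R_R$. An ideal $B$ is idempotent if $B=B^2$. Krull dimension (in the sense of Gordon and Robson) of a module $M$ is defined transfinitely (not every module has one): the zero module has $\operatorname{Kdim} M=-1$; every non-zero Artinian module has $\operatorname{Kdim} M=0$; for an ordinal $\alpha>0$, if the modules of Krull dimension $\beta$ are already defined for all $\beta<\alpha$ and $\operatorname{Kdim} M\neq\beta$ for every $\beta<\alpha$ (i.e. $M$ has not been assigned a Krull dimension smaller than $\alpha$), then $\operatorname{Kdim} M=\alpha$ if for any infinite properly descending chain $M_1>M_2>\ldots$ of submodules of $M$ there exists a positive integer $n$ such that $\operatorname{Kdim}(M_n/M_{n+1})<\alpha$. A module ''has Krull dimension'' if $\operatorname{Kdim} M$ is defined. A commutative ring $A$ has Krull dimension if the module $A_A$ does. *)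

(* Defs.v *)
From HB Require Import structures.
From mathcomp Require Import all_boot all_order all_algebra.
From mathcomp Require Import boolp classical_sets functions cardinality.

Set Implicit Arguments.
Unset Strict Implicit.
Unset Printing Implicit Defensive.

Import Order.TTheory GRing.Theory.
Local Open Scope classical_set_scope.
Local Open Scope ring_scope.
Local Open Scope quotient_scope.

(* Modules are [lmodType]s over a commutative ring, for which left and right
   modules coincide.  Submodules are the library's [submodClosed M], that is,
   boolean predicates closed under the operations; as [boolp] identifies
   [Prop] with [bool], these are all the submodules of [M]. *)

Section Submodule.
Variables (A : comNzRingType) (M : lmodType A) (N : submodClosed M).

Record submod_type := SubmodElt {
  submod_val :> M;
  submod_valP : submod_val \in N
}.

HB.instance Definition _ := [isSub for submod_val].
HB.instance Definition _ := [Choice of submod_type by <:].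
HB.instance Definition _ := [SubChoice_isSubLmodule of submod_type by <:].

End Submodule.

(* [N :&: P] as a submodule of the module [N]. *)
Section Restriction.
Variables (A : comNzRingType) (M : lmodType A) (N P : submodClosed M).

Definition submod_restr : pred (submod_type N) := fun x => val x \in P.

Lemma submod_restr_closed : submod_closed submod_restr.
Proof.
split=> [|a x y].
  by change (val (0 : submod_type N) \in P); rewrite raddf0 rpred0.
change (val x \in P -> val y \in P -> val (a *: x + y) \in P).
by move=> xP yP; rewrite linearP rpredD ?rpredZ.
Qed.

HB.instance Definition _ :=
  GRing.isSubmodClosed.Build A (submod_type N) submod_restr
    submod_restr_closed.

Definition restr_submod : submodClosed (submod_type N) :=
  GRing.SubmodClosed.clone A _ submod_restr _.

End Restriction.

(* The additive quotient group of the library, equipped with scalars. *)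
Section QuotientModule.
Variables (A : comNzRingType) (M : lmodType A) (N : submodClosed M).

Definition submod_pred : pred M := fun x => x \in N.

Lemma submod_pred_closed : zmod_closed submod_pred.
Proof. exact: GRing.submod_closedB (submodClosedP N). Qed.

HB.instance Definition _ :=
  GRing.isZmodClosed.Build M submod_pred submod_pred_closed.

Definition submod_zmod : zmodClosed M :=
  GRing.ZmodClosed.clone M submod_pred _.

Definition quotmod := {ideal_quot submod_zmod}.

HB.instance Definition _ := ZmodQuotient.on quotmod.

Definition quotmod_scale (a : A) (x : quotmod) : quotmod :=
  \pi_quotmod (a *: repr x).

Lemma pi_scale a (x : M) :
  quotmod_scale a (\pi_quotmod x) = \pi_quotmod (a *: x).
Proof.
apply/eqP; rewrite -Quotient.idealrBE -scalerBr.
apply: (@rpredZ _ _ N a); change (repr (\pi_quotmod x) - x \in submod_zmod).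
by rewrite Quotient.idealrBE reprK.
Qed.

Lemma pi_add (x y : M) :
  \pi_quotmod (x + y) = \pi_quotmod x + \pi_quotmod y.
Proof. exact: (raddfD \pi_({ideal_quot submod_zmod})). Qed.

Lemma quotmod_scalerA a b x :
  quotmod_scale a (quotmod_scale b x) = quotmod_scale (a * b) x.
Proof. by rewrite -[x]reprK (pi_scale b) !pi_scale scalerA. Qed.

Lemma quotmod_scale1r : left_id 1 quotmod_scale.
Proof. by move=> x; rewrite -[x]reprK pi_scale scale1r. Qed.

Lemma quotmod_scalerDr : right_distributive quotmod_scale +%R.
Proof.
move=> a x y; rewrite -[x]reprK -[y]reprK -pi_add !pi_scale.
by rewrite scalerDr pi_add.
Qed.

Lemma quotmod_scalerDl x : {morph quotmod_scale^~ x : a b / a + b}.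
Proof. by move=> a b; rewrite -[x]reprK !pi_scale scalerDl pi_add. Qed.

HB.instance Definition _ := GRing.Zmodule_isLmodule.Build A quotmod
  quotmod_scalerA quotmod_scale1r quotmod_scalerDr quotmod_scalerDl.

End QuotientModule.

(* [N / P], for submodules [P] and [N] of the same module with [P] contained
   in [N]. *)
Definition factor_module (A : comNzRingType) (M : lmodType A)
    (N P : submodClosed M) : lmodType A :=
  quotmod (restr_submod N P).

Definition zero_module (A : comNzRingType) (M : lmodType A) : Prop :=
  forall x : M, x = 0.

Definition zero_submod (A : comNzRingType) (M : lmodType A)
    (N : submodClosed M) : Prop :=
  [set` N] = [set 0].

Definition descending_chain (A : comNzRingType) (M : lmodType A)
    (N : nat -> submodClosed M) : Prop :=
  forall n, [set` N n.+1] `<` [set` N n].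

Definition artinian (A : comNzRingType) (M : lmodType A) : Prop :=
  ~ exists N : nat -> submodClosed M, descending_chain N.

(* Ordinals are represented as elements of a well-ordered type [W]: the
   ordinal of [x : W] is the order type of its initial segment, so that the
   least element of [W] is the ordinal 0. *)
Section KrullDimension.
Variables (A : comNzRingType) (d : Order.disp_t) (W : orderType d).
Hypothesis wfW : well_founded (fun x y : W => (x < y)%O).

Definition ord_zero (alpha : W) : Prop := forall beta, (alpha <= beta)%O.

(* "The Krull dimension of [M] is the ordinal [alpha]", where [Kd beta] is the
   same statement for the ordinals [beta] below [alpha].  The dimension -1 is
   not in [W], hence the clauses [zero_module]. *)
Definition Kdim_step (alpha : W)
    (Kd : forall beta : W, (beta < alpha)%O -> lmodType A -> Prop)
    (M : lmodType A) : Prop :=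
  (ord_zero alpha /\ ~ zero_module M /\ artinian M) \/
  [/\ ~ ord_zero alpha,
      ~ zero_module M /\
      (forall (beta : W) (lt_ba : (beta < alpha)%O), ~ Kd beta lt_ba M)
    & forall N : nat -> submodClosed M, descending_chain N ->
      exists n, let Q := factor_module (N n) (N n.+1) in
        zero_module Q \/
        exists (beta : W) (lt_ba : (beta < alpha)%O), Kd beta lt_ba Q].

Definition Kdim_ord : W -> lmodType A -> Prop :=
  Fix wfW (fun _ => lmodType A -> Prop) Kdim_step.

Lemma Kdim_ordE alpha :
  Kdim_ord alpha = @Kdim_step alpha (fun beta _ => Kdim_ord beta).
Proof.
rewrite /Kdim_ord Fix_eq // => x f g eqfg; congr Kdim_step.
by do 2![apply/functional_extensionality_dep => ?].
Qed.

(* [Kdim M None] stands for "Kdim M = -1". *)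
Definition Kdim (M : lmodType A) (alpha : option W) : Prop :=
  if alpha is Some a then Kdim_ord a M else zero_module M.

End KrullDimension.

Definition has_Krull_dimension (A : comNzRingType) (M : lmodType A) : Prop :=
  exists (d : Order.disp_t) (W : orderType d)
    (wfW : well_founded (fun x y : W => (x < y)%O)) (alpha : option W),
    Kdim wfW M alpha.

(* The sum of the family [N] is direct: a finite sum of elements of distinct
   members of the family vanishes only if all its terms do. *)
Definition direct_family (A : comNzRingType) (M : lmodType A) (I : choiceType)
    (N : I -> submodClosed M) : Prop :=
  forall (s : seq I) (x : I -> M), uniq s -> (forall i, x i \in N i) ->
    \sum_(i <- s) x i = 0 -> forall i, i \in s -> x i = 0.

Definition finite_dimensional (A : comNzRingType) (M : lmodType A) : Prop :=
  ~ exists (I : choiceType) (N : I -> submodClosed M),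
      [/\ infinite_set [set: I], forall i, ~ zero_submod (N i)
        & direct_family N].

Definition essential_submod (A : comNzRingType) (M : lmodType A)
    (X : submodClosed M) : Prop :=
  forall Y : submodClosed M, ~ zero_submod Y -> [set` X] `&` [set` Y] <> [set 0].

Notation ideal A := (submodClosed (A : comNzRingType)^o).

Definition ideal_add (A : comNzRingType) (X Y : set A) : set A :=
  [set x + y | x in X & y in Y].

Definition ideal_mul (A : comNzRingType) (X Y : set A) : set A :=
  [set z | exists (n : nat) (x y : 'I_n -> A),
    [/\ forall i, X (x i), forall i, Y (y i) & z = \sum_i x i * y i]].

(* Meet and join of ideals are the intersection and the sum. *)
Definition arithmetical (A : comNzRingType) : Prop :=
  forall I J K : ideal A,
    [set` I] `&` ideal_add [set` J] [set` K] =
    ideal_add ([set` I] `&` [set` J]) ([set` I] `&` [set` K]).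

Definition idempotent_ideal (A : comNzRingType) (I : ideal A) : Prop :=
  [set` I] = ideal_mul [set` I] [set` I].

Definition proper_submod (A : comNzRingType) (M : lmodType A)
    (N : submodClosed M) : Prop :=
  [set` N] <> [set: M].

Definition ring_has_Krull_dimension (A : comNzRingType) : Prop :=
  has_Krull_dimension A^o.

Definition ring_finite_dimensional (A : comNzRingType) : Prop :=
  finite_dimensional A^o.

(* Main.v *)
Require Import Defs.
From HB Require Import structures.
From mathcomp Require Import all_boot all_order all_algebra.
From mathcomp Require Import boolp classical_sets cardinality.
From mathcomp Require wochoice.

Import Order.TTheory GRing.Theory Num.Theory.
Local Open Scope classical_set_scope.
Local Open Scope ring_scope.

Set Implicit Arguments.
Unset Strict Implicit.
Unset Printing Implicit Defensive.

(** Whether a module [M] has Krull dimension depends only on its lattice of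
submodules, and the ordinals can be removed from the question. Call an interval
[[P, N]] of submodules dense when it can be split for ever: there is a
submodule strictly between [P] and [N] such that both halves can be split
again, and so on; [dense] is this greatest fixed point. A dense interval
contains an infinite descending chain with dense factors, so induction on the
ordinal shows that a module with Krull dimension is not dense
([has_Krull_dimension_not_dense]). Conversely, iterate the definition of Krull
dimension along a well-order with more elements than there are intervals: the
iteration becomes stationary, and an interval which it never reaches contains a
chain of intervals which it never reaches, hence is dense
([not_dense_has_Krull_dimension]). So the claim is that, for an arithmetical
ring [A], the interval from [0] to [A] is not dense if and only if all factor
rings are finite-dimensional without idempotent proper essential ideals.
Arithmeticity is used in the form [locally_chain]: for all [x], [y] there is
[u] such that [x] divides [(1 - u) y] and [y] divides [u x]; at each prime, [u]
or [1 - u] is a unit, so the localizations are chain rings.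

Suppose first that the factor rings satisfy this condition. The criterion
[no_dense_chain] is due to Lemonnier: if no factor of [M] contains an infinite
direct sum and each non-zero factor contains a non-zero cyclic submodule which
is not dense, then [M] is not dense. Here every non-zero [A / I] contains a
copy of [A / p] for some prime [p] ([exists_prime_annihilator]): by finite
dimensionality one may assume [A / I] uniform; the zero divisors modulo [I]
form a prime [p]. If [p] is not [I], then [p / I] is essential, hence not
idempotent, and any [x] outside [I] that sends an element of [p] outside [p^2 +
I] into [I] has annihilator [p] modulo [I]. Moreover prime ideals satisfy the
ascending chain condition, since the union of a strictly ascending chain is
idempotent ([prime_ascending_chain]). If [A / p] is dense, with [p] maximal for
this, then the interval from [p] to [A] splits at some [Z] strictly above [p]
with [A / Z] still dense, although all primes above [Z] are harmless: this
contradicts the criterion. So no [A / p] is dense, and by the criterion again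
[A] is not.

Conversely, a dense interval in a factor ring of [A] gives one in [A]. An
infinite direct sum contains a chain of partial sums ordered like the rationals
([independent_dense]). Let [B] be a proper essential idempotent ideal of a
factor ring. If some [z] in [B] survives in the localization at a maximal ideal
containing [B], then there [z] is a product of two elements of [B], these can
be factored again, and the ideals generated by the partial products form a
dense interval ([idempotent_dense]). Otherwise each [z] in [B] satisfies [z = z
b] for some [b] in [B], and since [B] is essential and proper it contains an
infinite direct sum ([pure_independent]). *)

(** * Submodules given by a closed set, and their lattice *)

Section SubmoduleOfSet.
Variables (A : comNzRingType) (M : lmodType A).
Implicit Types (S : M -> Prop) (P Q N : submodClosed M).

Lemma submodN P x : x \in P -> - x \in P.
Proof. by move=> xP; rewrite -scaleN1r rpredZ. Qed.

Lemma submodB P x y : x \in P -> y \in P -> x - y \in P.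
Proof. by move=> xP yP; rewrite rpredD // submodN. Qed.

Definition is_submod S :=
  S 0 /\ forall a x y, S x -> S y -> S (a *: x + y).

Lemma is_submod_closed S : is_submod S -> submod_closed (fun x => `[< S x >]).
Proof.
move=> [S0 SD]; split=> [|a x y]; first exact/asboolP.
by move=> /asboolP Sx /asboolP Sy; apply/asboolP; apply: SD.
Qed.

Definition submod_of S (H : is_submod S) : submodClosed M :=
  HB.pack (fun x : M => `[< S x >])
    (GRing.isSubmodClosed.Build A M (fun x => `[< S x >]) (is_submod_closed H)).

Lemma submod_ofP S (H : is_submod S) x : x \in submod_of H <-> S x.
Proof. by split=> /asboolP. Qed.

Lemma bot_is_submod : is_submod (fun x => x = 0).
Proof. by split=> // a x y -> ->; rewrite scaler0 addr0. Qed.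

Lemma top_is_submod : is_submod (fun x => True).
Proof. by []. Qed.

Lemma meet_is_submod (P Q : submodClosed M) :
  is_submod (fun x => x \in P /\ x \in Q).
Proof.
split=> [|a x y [xP xQ] [yP yQ]]; first by rewrite !rpred0.
by split; rewrite rpredD // rpredZ.
Qed.

Lemma join_is_submod (P Q : submodClosed M) :
  is_submod (fun x => exists2 p, p \in P & x - p \in Q).
Proof.
split=> [|a x y [p pP xQ] [q qP yQ]]; first by exists 0; rewrite ?subr0 ?rpred0.
exists (a *: p + q); first by rewrite rpredD ?rpredZ.
have -> : a *: x + y - (a *: p + q) = a *: (x - p) + (y - q).
  by rewrite scalerBr opprD addrACA.
by rewrite rpredD ?rpredZ.
Qed.

Lemma adjoin_is_submod (P : submodClosed M) (x : M) :
  is_submod (fun y => exists a, y - a *: x \in P).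
Proof.
split=> [|c y z [a yP] [b zP]]; first by exists 0; rewrite scale0r subr0 rpred0.
exists (c * a + b).
have -> : c *: y + z - (c * a + b) *: x = c *: (y - a *: x) + (z - b *: x).
  by rewrite scalerDl opprD scalerBr scalerA addrACA.
by rewrite rpredD ?rpredZ.
Qed.

Definition bot := submod_of bot_is_submod.
Definition top := submod_of top_is_submod.
Definition meet P Q := submod_of (meet_is_submod P Q).
Definition join P Q := submod_of (join_is_submod P Q).
Definition adjoin P x := submod_of (adjoin_is_submod P x).

Lemma mem_bot x : x \in bot <-> x = 0.
Proof. exact: submod_ofP. Qed.

Lemma mem_top x : x \in top.
Proof. exact/submod_ofP. Qed.

Lemma mem_meet P Q x : x \in meet P Q <-> x \in P /\ x \in Q.
Proof. exact: submod_ofP. Qed.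

Lemma mem_join P Q x :
  x \in join P Q <-> exists2 p, p \in P & x - p \in Q.
Proof. exact: submod_ofP. Qed.

Lemma mem_adjoin P y x :
  x \in adjoin P y <-> exists a, x - a *: y \in P.
Proof. exact: submod_ofP. Qed.

Lemma mem_adjoin_gen P x : x \in adjoin P x.
Proof. by apply/mem_adjoin; exists 1; rewrite scale1r subrr rpred0. Qed.

Lemma mem_adjoinZ P x a : a *: x \in adjoin P x.
Proof. by rewrite rpredZ ?mem_adjoin_gen. Qed.

Lemma sub_adjoin P x : {subset P <= adjoin P x}.
Proof. by move=> y yP; apply/mem_adjoin; exists 0; rewrite scale0r subr0. Qed.

Lemma adjoin_sub (P N : submodClosed M) x :
  {subset P <= N} -> x \in N -> {subset adjoin P x <= N}.
Proof.
move=> PN xN y /mem_adjoin[a /PN yP].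
by rewrite -(subrK (a *: x) y) rpredD // rpredZ.
Qed.

Lemma meet_subr P Q : {subset meet P Q <= Q}.
Proof. by move=> x /mem_meet[]. Qed.

Lemma sub_joinl P Q : {subset P <= join P Q}.
Proof. by move=> x xP; apply/mem_join; exists x; rewrite // subrr rpred0. Qed.

Lemma sub_joinr P Q : {subset Q <= join P Q}.
Proof. by move=> x xQ; apply/mem_join; exists 0; rewrite ?rpred0 // subr0. Qed.

Lemma join_sub (P Q N : submodClosed M) :
  {subset P <= N} -> {subset Q <= N} -> {subset join P Q <= N}.
Proof.
move=> PN QN x /mem_join[p /PN pN /QN xN].
by rewrite -(subrK p x) rpredD.
Qed.

Lemma meet_sub_meet (P P' Q : submodClosed M) :
  {subset P <= P'} -> {subset meet P Q <= meet P' Q}.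
Proof. by move=> PP' x /mem_meet[xP xQ]; apply/mem_meet; split=> //;
  apply: PP'. Qed.

Lemma join_sub_join (P P' Q : submodClosed M) :
  {subset P <= P'} -> {subset join P Q <= join P' Q}.
Proof.
move=> PP'; apply: join_sub; last exact: sub_joinr.
by move=> x /PP'; apply: sub_joinl.
Qed.

End SubmoduleOfSet.
Arguments bot {A M}.
Arguments top {A M}.

(** * Intervals that can be split for ever *)

Section Dense.
Variables (A : comNzRingType) (M : lmodType A).
Implicit Types P N U X Y Z : submodClosed M.

Definition strict P N := {subset P <= N} /\ exists2 x, x \in N & x \notin P.

Definition splitting (R : submodClosed M -> submodClosed M -> Prop) :=
  forall X Y, R X Y -> strict X Y /\ exists Z, R X Z /\ R Z Y.

(** The greatest fixed point of the splitting condition. It stands for the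
absence of a Krull dimension of [N / P]. *)
Definition dense P N := exists2 R, splitting R & R P N.

Lemma dense_split : splitting dense.
Proof.
move=> X Y [R sR RXY]; have [sXY [Z [RXZ RZY]]] := sR _ _ RXY.
by split=> //; exists Z; split; exists R.
Qed.

Lemma dense_strict P N : dense P N -> strict P N.
Proof. by case/dense_split. Qed.

Lemma dense_sub P N : dense P N -> {subset P <= N}.
Proof. by case/dense_strict. Qed.

Lemma dense_mono P N P' N' :
  {subset P' <= P} -> {subset N <= N'} -> dense P N -> dense P' N'.
Proof.
move=> PP NN dPN.
exists (fun X Y => exists P N, [/\ {subset X <= P},
  {subset N <= Y} & dense P N]);
  last by exists P, N; split.
move=> X Y [P0 [N0 [XP NY dPN0]]].
have [[PN [x xN xP]] [Z [dPZ dZN]]] := dense_split dPN0; split.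
  split; first by move=> y /XP/PN/NY.
  by exists x; [exact: NY | apply: contra xP; exact: XP].
by exists Z; split; [exists P0, Z | exists Z, N0]; split.
Qed.

(** Intersecting with [U] maps the intervals inside [[P, N]] to intervals
inside [[P :&: U, N :&: U]]. If this map never collapsed a dense interval, then
the images would split for ever too. *)
Lemma dense_stationary P N U : dense P N -> ~ dense (meet P U) (meet N U) ->
  exists P' N', [/\ {subset P <= P'}, {subset N' <= N}, dense P' N'
                  & {subset meet N' U <= P'}].
Proof.
move=> dPN; apply: contra_notP => noPN.
exists (fun X Y => exists P' N', [/\ {subset P <= P'}, {subset N' <= N},
    dense P' N', X = meet P' U & Y = meet N' U]); last by exists P, N; split.
move=> _ _ [P' [N' [PP' N'N dPN' -> ->]]]; split.
  split; first by apply: meet_sub_meet; apply: dense_sub.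
  apply: contra_notP noPN => noX; exists P', N'; split=> // x xNU.
  apply: contrapT => /negP xP'; apply: noX; exists x => //.
  by apply: contra xP' => /mem_meet[].
have [_ [Z [dPZ dZN]]] := dense_split dPN'.
exists (meet Z U); split; [exists P', Z | exists Z, N']; split=> // x.
  by move/(dense_sub dZN)/N'N.
by move/PP'/(dense_sub dPZ).
Qed.

(** On an interval where intersecting with [U] is constant, adding [U] is
injective by the modular law. *)
Lemma dense_join P N U :
  dense P N -> {subset meet N U <= P} -> dense (join P U) (join N U).
Proof.
move=> dPN NUP.
exists (fun X Y => exists P' N', [/\ {subset P <= P'}, {subset N' <= N},
    dense P' N', X = join P' U & Y = join N' U]); last by exists P, N; split.
move=> _ _ [P' [N' [PP' N'N dPN' -> ->]]].
have [[P'N' [x xN' xP']] [Z [dPZ dZN]]] := dense_split dPN'; split.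
  split; first exact: join_sub_join.
  exists x; first exact: sub_joinl.
  apply: contra xP' => /mem_join[p pP' xpU].
  rewrite -(subrK p x) rpredD // PP' // NUP //; apply/mem_meet; split=> //.
  by apply: N'N; apply: submodB => //; apply: P'N'.
exists (join Z U); split; [exists P', Z | exists Z, N']; split=> // y.
  by move/(dense_sub dZN)/N'N.
by move/PP'/(dense_sub dPZ).
Qed.

(** A dense interval inside [[P, N]] whose trace on [X] is constant embeds in
[[X, N]]. *)
Lemma dense_extension P X N :
  {subset P <= X} -> {subset X <= N} -> dense P N -> dense P X \/ dense X N.
Proof.
move=> PX XN dPN; have [|ndPX] := pselect (dense P X); [by left | right].
have [|P' [N' [PP' N'N dPN' N'X]]] := @dense_stationary P N X dPN.
  by apply: contra_not ndPX; apply: dense_mono => y;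
    [move=> yP; apply/mem_meet; split=> //; apply: PX | case/mem_meet].
apply: dense_mono (dense_join dPN' N'X); first exact: sub_joinr.
exact: join_sub.
Qed.

(** By the second isomorphism theorem, [(X + U) / X] is [U / (X :&: U)]. *)
Lemma dense_quotient X U : dense X (join X U) -> dense (meet X U) U.
Proof.
move=> dXU.
exists (fun Y Z => exists Y' Z', [/\ {subset X <= Y'}, {subset Z' <= join X U},
    dense Y' Z', {subset Y <= meet Y' U} & {subset meet Z' U <= Z}]);
      last first.
  exists X, (join X U); split=> // y; last by case/mem_meet.
move=> Y Z [Y' [Z' [XY Z'U dYZ YU UZ]]].
have [[Y'Z' [x xZ' xY']] [V [dYV dVZ]]] := dense_split dYZ; split.
  split.
    by move=> y /YU/mem_meet[/Y'Z' yZ' yU]; apply: UZ; apply/mem_meet.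
  have /mem_join[p pX xpU] := Z'U _ xZ'; exists (x - p).
    apply: UZ; apply/mem_meet; split=> //; rewrite submodB //.
    by rewrite Y'Z' // XY.
  apply: contra xY' => /YU/mem_meet[xpY' _].
  by rewrite -(subrK p x) rpredD // XY.
exists (meet V U); split; [exists Y', V | exists V, Z']; split=> // y.
  by move/(dense_sub dVZ)/Z'U.
by move/XY/(dense_sub dYV).
Qed.

Lemma dense_adjoin P P' x :
  {subset P <= P'} -> dense P' (adjoin P' x) -> dense P (adjoin P x).
Proof.
move=> PP' dP'; have: dense P' (join P' (adjoin P x)).
  apply: dense_mono dP' => // y /mem_adjoin[a ya]; apply/mem_join.
  by exists (y - a *: x); rewrite // subKr mem_adjoinZ.
move/dense_quotient; apply: dense_mono => // y yP; apply/mem_meet.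
by split; [exact: PP' | exact: sub_adjoin].
Qed.

End Dense.

(** * The criterion of Lemonnier *)

Section Independence.
Variables (A : comNzRingType) (M : lmodType A).
Implicit Types L P N Z : submodClosed M.

(** Cyclic submodules suffice to detect infinite direct sums, so a direct
family in [M / L] is recorded by generators of its members. *)
Definition independent (I : eqType) L (x : I -> M) :=
  (forall i, x i \notin L) /\
  forall (s : seq I) (c : I -> A), uniq s ->
    \sum_(i <- s) c i *: x i \in L -> forall i, i \in s -> c i *: x i \in L.

(** Each submodule [Z n] contains all later elements but meets the multiples of
[x n] only in [L], so the terms of a sum in [L] lie in [L] one after another.
*)
Lemma independent_triangular L (x : nat -> M) (Z : nat -> submodClosed M) :
  (forall n, x n \notin L) ->
  (forall n, {subset L <= Z n}) ->
  (forall m n, (n < m)%N -> x m \in Z n) ->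
  (forall n a, a *: x n \in Z n -> a *: x n \in L) ->
  independent L x.
Proof.
move=> xL LZ xZ ZL; split=> // s c us sL i.
elim/ltn_ind: i => i IH si; apply: ZL.
have := LZ i _ sL; rewrite (bigD1_seq i) //= => sZ.
rewrite -(addrK (\sum_(j <- s | j != i) c j *: x j) (c i *: x i)).
apply: submodB => //.
rewrite big_seq_cond rpred_sum // => j /andP[sj ji].
have [ij|ij|eij] := ltngtP i j; first by rewrite rpredZ ?xZ.
  exact/LZ/IH.
by rewrite eij eqxx in ji.
Qed.

Lemma bigcup_is_submod (P : nat -> submodClosed M) :
  (forall n, {subset P n <= P n.+1}) ->
  is_submod (fun x => exists n, x \in P n).
Proof.
move=> PS; have Pmono m n : (m <= n)%N -> {subset P m <= P n}.
  move=> /subnK <-; elim: (n - m)%N => [//|k IH] x /IH; exact: PS.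
split=> [|a x y [m xP] [n yP]]; first by exists 0%N; rewrite rpred0.
exists (maxn m n); rewrite rpredD ?rpredZ //.
  by apply: Pmono xP; rewrite leq_maxl.
by apply: Pmono yP; rewrite leq_maxr.
Qed.

(** In a dense [[P, N]] with middle [Z], an element [x] of [N] outside [Z]
generates a submodule that is not dense above [P], so a dense interval [[P',
N']] inside [[P, Z]] has constant trace on it. Repeating this in [[P', N']] and
taking the union [L] of the lower ends, the elements [x] become independent
modulo [L]. *)
Lemma dense_independent P N : dense P N ->
  (forall x, x \in N -> ~ dense P (adjoin P x)) ->
  exists L (x : nat -> M), {subset P <= L} /\ independent L x.
Proof.
move=> dPN ndx.
pose St := {PN : submodClosed M * submodClosed M |
  [/\ {subset P <= PN.1}, {subset PN.2 <= N} & dense PN.1 PN.2]}.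
have step (s : St) : exists xs : M * St,
    [/\ xs.1 \in (sval s).2, xs.1 \notin (sval xs.2).2,
        {subset (sval s).1 <= (sval xs.2).1},
        {subset (sval xs.2).2 <= (sval s).2} &
        {subset meet (sval xs.2).2 (adjoin (sval s).1 xs.1)
          <= (sval xs.2).1}].
  case: s => [[P1 N1] /= [PP1 N1N d1]].
  have [_ [Z [dPZ dZN]]] := dense_split d1.
  have [_ [x xN1 xZ]] := dense_strict dZN.
  have [|P2 [N2 [P12 N2Z d2 NUP]]] :=
    @dense_stationary _ _ _ _ (adjoin P1 x) dPZ.
    move=> dU; apply: (ndx x (N1N _ xN1));
      apply: (@dense_adjoin _ _ _ P1) => //.
    apply: dense_mono dU => [y yP|]; last exact: meet_subr.
    by apply/mem_meet; split=> //; apply: sub_adjoin.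
  have s2 : [/\ {subset P <= P2}, {subset N2 <= N} & dense P2 N2].
    split=> // y; first by move/PP1/P12.
    by move/N2Z/(dense_sub dZN)/N1N.
  exists (x, exist _ (P2, N2) s2); split=> //=.
    by apply: contra xZ; apply: N2Z.
  by move=> y /N2Z/(dense_sub dZN).
have [f fP] := choice step.
have PN0 : [/\ {subset P <= P}, {subset N <= N} & dense P N] by split.
pose s0 : St := exist _ (P, N) PN0.
pose s n := iter n (fun s => (f s).2) s0.
pose x n := (f (s n)).1; pose Ps n := (sval (s n)).1;
  pose Ns n := (sval (s n)).2.
have PS n : {subset Ps n <= Ps n.+1} by case: (fP (s n)).
have NS n : {subset Ns n.+1 <= Ns n} by case: (fP (s n)).
have NN m n : (m <= n)%N -> {subset Ns n <= Ns m}.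
  move=> /subnK <-; elim: (n - m)%N => [//|k IH] y /NS; exact: IH.
have PPm m n : (m <= n)%N -> {subset Ps m <= Ps n}.
  move=> /subnK <-; elim: (n - m)%N => [//|k IH] y /IH; exact: PS.
have PN n : {subset Ps n <= Ns n}.
  by apply: dense_sub; rewrite /Ps /Ns; case: (svalP (s n)).
exists (submod_of (bigcup_is_submod PS)), x.
have LN n : {subset submod_of (bigcup_is_submod PS) <= Ns n}.
  move=> y /submod_ofP[m ym]; case: (leqP m n) => [mn|/ltnW nm].
    exact/PN/(PPm m).
  exact/(NN n m nm)/PN.
split; first by move=> y yP; apply/submod_ofP; exists 0%N.
apply: (@independent_triangular _ _ (fun n => Ns n.+1)) => //.
- move=> n; case: (fP (s n)) => _ xn _ _ _; apply: contra xn; exact: (LN n.+1).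
- by move=> m n nm; apply: (NN n.+1 m) => //; case: (fP (s m)).
- move=> n a aN; apply/submod_ofP; exists n.+1.
  case: (fP (s n)) => _ _ _ _; apply; apply/mem_meet; split=> //.
  exact: mem_adjoinZ.
Qed.

(** The elements that generate a submodule which is not dense above [P0] form a
submodule [T], and [T] is not dense above [P0] by [dense_independent]. If [T]
were not everything, then a non-zero cyclic submodule of [M / T] that is not
dense could be added to [T]. *)
Theorem no_dense_chain (P0 : submodClosed M) :
  (forall L (x : nat -> M), {subset P0 <= L} -> ~ independent L x) ->
  (forall P, {subset P0 <= P} -> (exists x, x \notin P) ->
     exists2 x, x \notin P & ~ dense P (adjoin P x)) ->
  ~ dense P0 top.
Proof.
move=> noind crit.
have ndcyc N : (forall x, x \in N -> ~ dense P0 (adjoin P0 x)) -> ~ dense P0 N.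
  by move=> ndx dPN; have [L [x [PL]]] := dense_independent dPN ndx;
    apply: noind.
have T_is_submod : is_submod (fun x => ~ dense P0 (adjoin P0 x)).
  split=> [|a x y dx dy].
    move/dense_strict=> [_ [y /mem_adjoin[a]]].
    by rewrite scaler0 subr0 => ->.
  move=> dxy.
  have [] := @dense_extension _ _ P0 (adjoin P0 x) (adjoin (adjoin P0 x) y).
  - exact: sub_adjoin.
  - exact: sub_adjoin.
  - apply: dense_mono dxy => //; apply: adjoin_sub.
      by move=> z zP; do 2![apply: sub_adjoin].
    rewrite rpredD ?mem_adjoin_gen // rpredZ //; apply: sub_adjoin.
    exact: mem_adjoin_gen.
  - by [].
  - by move/(dense_adjoin (@sub_adjoin _ _ P0 x)).
pose T := submod_of T_is_submod.
have P0T : {subset P0 <= T}.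
  move=> x xP; apply/submod_ofP => /dense_strict[_ [y /(adjoin_sub _ xP) yP]].
  by rewrite yP.
have ndT : ~ dense P0 T by apply: ndcyc => x /submod_ofP.
have [[x xT]|allT] := pselect (exists x, x \notin T); last first.
  apply: contra_not ndT; apply: dense_mono => // y _.
  by apply: contrapT => /negP yT; apply: allT; exists y.
have [|y yT ndy] := crit T P0T; first by exists x.
case/negP: yT; apply/submod_ofP => dy.
have [||] // := @dense_extension _ _ P0 T (adjoin T y) P0T
  (@sub_adjoin _ _ T y).
apply: dense_mono dy => //; apply: adjoin_sub; last exact: mem_adjoin_gen.
by move=> z /P0T/(@sub_adjoin _ _ T y).
Qed.
End Independence.

(** * Factor modules *)

Section FactorModule.
Variables (A : comNzRingType) (M : lmodType A) (N P : submodClosed M).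
Local Open Scope quotient_scope.

Definition proj (x : submod_type N) : factor_module N P :=
  \pi_(quotmod (restr_submod N P)) x.

Lemma projP a x y : proj (a *: x + y) = a *: proj x + proj y.
Proof. by rewrite /proj Defs.pi_add -pi_scale. Qed.

Lemma proj0 : proj 0 = 0.
Proof.
by rewrite -[X in proj X](addr0) -{1}(scaler0 _ (-1)) projP scaleN1r addNr.
Qed.

Lemma proj_eq x y : proj x = proj y <-> val x - val y \in P.
Proof.
have -> : (val x - val y \in P) =
    (x - y \in submod_zmod (restr_submod N P)) by rewrite -raddfB.
by rewrite Quotient.idealrBE; split=> [e|/eqP //]; apply/eqP.
Qed.

Lemma proj_surj q : exists x, q = proj x.
Proof. by exists (repr q); rewrite /proj reprK. Qed.

Lemma image_is_submod (X : submodClosed M) :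
  is_submod (fun q => exists2 x : submod_type N, val x \in X & q = proj x).
Proof.
split=> [|a _ _ [x xX ->] [y yX ->]].
  exists 0; first by rewrite raddf0 rpred0.
  by rewrite proj0.
exists (a *: x + y); last by rewrite projP.
by rewrite linearP rpredD ?rpredZ.
Qed.
Definition image X := submod_of (image_is_submod X).

Lemma preimage_is_submod (U : submodClosed (factor_module N P)) :
  is_submod (fun x => exists2 y : submod_type N, val y = x & proj y \in U).
Proof.
split=> [|a _ _ [x <- xU] [y <- yU]].
  exists 0; first exact: raddf0.
  by rewrite proj0 rpred0.
by exists (a *: x + y); [rewrite linearP | rewrite projP rpredD ?rpredZ].
Qed.
Definition preimage U := submod_of (preimage_is_submod U).

End FactorModule.

(** * A well-order on every type *)

Section WellOrder.
Variable T : choiceType.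

Definition wo_type : predArgType := T.
HB.instance Definition _ := Choice.on wo_type.

Definition wo_le : rel wo_type := sval (wochoice.well_ordering_principle T).

Let wo_wo : wochoice.wo_chain wo_le (mem wo_type).
Proof.
apply: wochoice.withinW.
exact: (svalP (wochoice.well_ordering_principle T)).
Qed.

Lemma wo_total : total wo_le.
Proof. by move=> x y; apply: (wochoice.wo_chainW wo_wo). Qed.

Lemma wo_anti : antisymmetric wo_le.
Proof. by move=> x y; apply: (wochoice.wo_chain_antisymmetric wo_wo). Qed.

Lemma wo_min (P : pred T) : (exists x, P x) ->
  exists2 x, P x & forall y, P y -> wo_le x y.
Proof.
move=> [x Px]; case: (svalP (wochoice.well_ordering_principle T) P).
  by exists x.
by move=> z [[Pz zmin] _]; exists z.
Qed.

Lemma wo_trans : transitive wo_le.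
Proof.
move=> y x z xy yz.
have [t] := @wo_min (pred3 x y z) (ex_intro _ x (predU1l _ erefl)).
move=> /or3P[] /eqP -> le_t; first by apply: le_t; rewrite /= eqxx !orbT.
- have yx : wo_le y x by apply: le_t; rewrite /= eqxx.
  by rewrite (@wo_anti x y) ?xy.
- have zy : wo_le z y by apply: le_t; rewrite /= eqxx orbT.
  by rewrite -(@wo_anti y z) ?yz.
Qed.

HB.instance Definition _ := Order.isOrder.Build (Order.Disp tt tt) wo_type
  (fun=> fun=> erefl) (fun=> fun=> erefl) (fun=> fun=> erefl)
  wo_anti wo_trans wo_total.

Lemma wo_type_wf : well_founded (fun x y : wo_type => (x < y)%O).
Proof.
move=> x; apply: contrapT => nAx.
have [y /asboolPn nAy ymin] := @wo_min
  (fun y => ~~ `[< Acc (fun x y : wo_type => (x < y)%O) y >])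
  (ex_intro _ x (introT (asboolPn _) nAx)).
apply: nAy; split=> z zy; apply: contrapT => nAz.
have /(_ (introT (asboolPn _) nAz)) := ymin z.
by move=> yz; move: zy; rewrite ltNge => /negP; apply.
Qed.
End WellOrder.

(** * Krull dimension excludes dense intervals *)

Section KrullDense.
Variable A : comNzRingType.
Implicit Types M : lmodType A.

Lemma descending_chainP M (N : nat -> submodClosed M) :
  descending_chain N <-> forall n, strict (N n.+1) (N n).
Proof.
split=> NS n; have := NS n.
  move=> [NN nN]; split; first exact: NN.
  apply: contra_notP nN => nx x xN; apply: contrapT => /negP xN'.
  by apply: nx; exists x.
move=> [NN [x xN xN']]; split; first exact: NN.
by move=> /(_ x xN) /= xN2; rewrite xN2 in xN'.
Qed.

(** The submodules of the factor module [N / P] are the images of the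
submodules between [P] and [N]. *)
Lemma dense_factor M (N P : submodClosed M) :
  dense P N -> dense (bot : submodClosed (factor_module N P)) top.
Proof.
move=> dPN; exists (fun X Y : submodClosed (factor_module N P) =>
  exists X' Y' : submodClosed M, [/\ {subset P <= X'},
   {subset Y' <= N}, dense X' Y', {subset X <= image N P X'} &
   {subset image N P Y' <= Y}]); last first.
  exists P, N; split=> // y; last by rewrite mem_top.
  move=> /mem_bot ->; exact: rpred0.
move=> X Y [X' [Y' [PX' Y'N d' XX' Y'Y]]].
have [[X'Y' [x xY' xX']] [Z [dXZ dZY]]] := dense_split d'; split.
  split.
    move=> q /XX'/submod_ofP[z zX ->]; apply: Y'Y; apply/submod_ofP.
    by exists z => //; apply: X'Y'.
  exists (proj P (SubmodElt (Y'N _ xY'))).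
    by apply: Y'Y; apply/submod_ofP; exists (SubmodElt (Y'N _ xY')).
  apply: contra xX' => /XX'/submod_ofP[z zX /proj_eq/PX'] /= xz.
  by rewrite -(subrK (val z) x) rpredD.
exists (image N P Z); split; [exists X', Z | exists Z, Y']; split=> // y.
  by move/(dense_sub dZY)/Y'N.
by move/PX'/(dense_sub dXZ).
Qed.

(** Always keep the lower half of the interval. *)
Lemma artinian_not_dense M P N : artinian M -> ~ @dense A M P N.
Proof.
move=> artM dPN; apply: artM.
pose St := {X : submodClosed M | dense P X}.
have step (s : St) : exists s' : St, strict (sval s') (sval s).
  case: s => X dX /=; have [_ [Z [dPZ dZX]]] := dense_split dX.
  by exists (exist _ Z dPZ); apply: dense_strict.
have [f fP] := choice step.
exists (fun n => sval (iter n f (exist _ N dPN))); apply/descending_chainP => n.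
exact: fP.
Qed.

(** Keeping the lower half of the interval at each step gives a descending
chain in which every factor is dense, against the induction hypothesis. *)
Lemma Kdim_ord_not_dense d (W : orderType d)
    (wfW : well_founded (fun x y : W => (x < y)%O)) (a : W) M :
  Kdim_ord wfW a M -> ~ dense (bot : submodClosed M) top.
Proof.
elim/(well_founded_ind wfW): a M => a IH M.
rewrite Kdim_ordE => -[[_ [_ artM]] | [_ _ chainM] dM].
  exact: artinian_not_dense.
pose St := {X : submodClosed M | dense bot X}.
have step (s : St) : exists s' : St, dense (sval s') (sval s).
  case: s => X dX /=; have [_ [Z [dPZ dZX]]] := dense_split dX.
  by exists (exist _ Z dPZ).
have [f fP] := choice step.
pose N n := sval (iter n f (exist _ top dM)).
have dN n : dense (N n.+1) (N n) by exact: fP.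
have [|n] := chainM N; first by apply/descending_chainP => n;
  apply/dense_strict/dN.
case=> [zQ|[b [ltba Kb]]]; last exact: (IH b ltba _ Kb (dense_factor (dN n))).
have [_ [x _ xb]] := dense_strict (dense_factor (dN n)).
by rewrite (zQ x) rpred0 in xb.
Qed.

Lemma has_Krull_dimension_not_dense M :
  has_Krull_dimension M -> ~ dense (bot : submodClosed M) top.
Proof.
move=> [d [W [wfW [[a|] /=]]]]; first exact: Kdim_ord_not_dense.
by move=> zM /dense_strict[_ [x _]]; rewrite (zM x) rpred0.
Qed.
End KrullDense.

(** * Without dense intervals there is a Krull dimension *)

Section DenseKrull.
Variable A : comNzRingType.
Implicit Types M : lmodType A.

(** Krull dimension at most [a], read on the intervals of one fixed module, so
that no factor modules of factor modules occur. *)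
Inductive rank_le M d (W : orderType d) (a : W) (X Y : submodClosed M) : Prop :=
  RankLe of forall N : nat -> submodClosed M,
    (forall n, strict (N n.+1) (N n)) ->
    (forall n, {subset X <= N n} /\ {subset N n <= Y}) ->
    exists n b, (b < a)%O /\ rank_le b (N n.+1) (N n).

Lemma rank_le_mono M d (W : orderType d) (a a' : W)
    (X Y X' Y' : submodClosed M) :
  (a <= a')%O -> {subset X <= X'} -> {subset Y' <= Y} ->
  rank_le a X Y -> rank_le a' X' Y'.
Proof.
move=> aa' XX' YY' [H]; split=> N NS XNY.
have [|n [b [ltba rb]]] := H N NS.
  by move=> n; have [XN NY] := XNY n; split=> x; [move/XX'/XN | move/NY/YY'].
by exists n, b; split=> //; apply: lt_le_trans aa'.
Qed.

Lemma preimage_mono M (N P : submodClosed M)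
    (U V : submodClosed (factor_module N P)) :
  {subset U <= V} -> {subset preimage U <= preimage V}.
Proof.
move=> UV x /submod_ofP[y yx yU]; apply/submod_ofP; exists y => //; exact: UV.
Qed.

Lemma preimage_strict M (N P : submodClosed M)
    (U V : submodClosed (factor_module N P)) :
  strict U V -> strict (preimage U) (preimage V).
Proof.
move=> [UV [q qV qU]]; split; first exact: preimage_mono.
have [x qx] := proj_surj q; exists (val x).
  by apply/submod_ofP; exists x => //; rewrite -qx.
apply: contra qU => /submod_ofP[y /val_inj -> ].
by rewrite -qx.
Qed.

Lemma preimage_between M (N P : submodClosed M)
    (U : submodClosed (factor_module N P)) :
  {subset P <= N} -> {subset P <= preimage U} /\ {subset preimage U <= N}.
Proof.
move=> PN; split=> x; last by move=> /submod_ofP[y <- _]; apply: submod_valP.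
move=> xP; apply/submod_ofP; exists (SubmodElt (PN _ xP)) => //.
have -> : proj P (SubmodElt (PN _ xP)) = proj P 0.
  apply/proj_eq; have -> : val (0 : submod_type N) = 0 by exact: raddf0.
  by rewrite subr0.
by rewrite proj0 rpred0.
Qed.

(** The induction moves from [Q] to a factor of two of its submodules;
embedding the submodules of [Q] in those of [M] keeps all ranks on the same
module. *)
Lemma rank_le_Kdim d (W : orderType d)
    (wfW : well_founded (fun x y : W => (x < y)%O)) M (a : W)
    (X Y : submodClosed M) (Q : lmodType A)
    (f : submodClosed Q -> submodClosed M) :
  rank_le a X Y ->
  (forall U V : submodClosed Q, {subset U <= V} -> {subset f U <= f V}) ->
  (forall U V, strict U V -> strict (f U) (f V)) ->
  (forall U, {subset X <= f U} /\ {subset f U <= Y}) ->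
  zero_module Q \/ exists b : W, (b <= a)%O /\ Kdim_ord wfW b Q.
Proof.
elim/(well_founded_ind wfW): a X Y Q f => a IH X Y Q f [H] fM fS fXY.
have [zQ|nzQ] := pselect (zero_module Q); [by left | right].
have [[b [ltba Kb]]|nK] :=
  pselect (exists b : W, (b < a)%O /\ Kdim_ord wfW b Q).
  by exists b; split=> //; apply: ltW.
exists a; split=> //; rewrite Kdim_ordE.
have [a0|na0] := pselect (ord_zero a); [left | right].
  split=> //; split=> // -[N /descending_chainP NS].
  have [||n [b [ltba _]]] := H (f \o N); [by move=> n; apply: fS | by move=> n;
    apply: fXY|].
  by have := a0 b; rewrite leNgt ltba.
split=> //.
  by split=> // b ltba Kb; apply: nK; exists b.
move=> N /descending_chainP NS.
have [||n [b [ltba rb]]] := H (f \o N); [by move=> n; apply: fS | by move=> n;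
  apply: fXY|].
exists n.
have [NN _] := NS n.
have [| | | |[c [cb Kc]]] := IH b ltba (f (N n.+1)) (f (N n))
  (factor_module (N n) (N n.+1)) (fun U => f (preimage U)) rb.
- by move=> U V /preimage_mono; apply: fM.
- by move=> U V /preimage_strict; apply: fS.
- move=> U; have [NU UN] := preimage_between U NN.
  by split; apply: fM.
- by left.
- by right; exists c; exists (le_lt_trans cb ltba).
Qed.

Lemma no_injection_powerset (S : Type) (g : set S -> S) : ~ injective g.
Proof.
move=> g_inj; pose D : set S := fun s => exists B, g B = s /\ ~ B s.
have nDD : ~ D (g D).
  by move=> DD; move: (DD) => [B [/g_inj -> ]]; apply.
by apply: (nDD); exists D.
Qed.

(** Ordinals are the elements of a well-order on the subsets of the set of
intervals. As there is no injection of them into the intervals, some ordinal is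
not the exact rank of any interval; it then bounds every rank that occurs, so
that the intervals without a rank split for ever. *)
Theorem not_dense_has_Krull_dimension M :
  ~ dense (bot : submodClosed M) top -> has_Krull_dimension M.
Proof.
move=> ndM.
pose S := (submodClosed M * submodClosed M)%type.
pose W : orderType _ := wo_type {classic (set S)}.
have wfW : well_founded (fun x y : W => (x < y)%O) := @wo_type_wf _.
pose rk (a : W) (s : S) := rank_le a s.1 s.2.
have [a0 a0P] : exists a : W,
    forall s, (exists b, rk b s) -> exists2 b, (b < a)%O & rk b s.
  have [a aP] : exists a : W, forall s, rk a s -> exists2 b, (b < a)%O & rk b s.
    apply: contrapT => noa.
    (* If every [a] is the exact rank of an interval, choosing one for each [a]
       injects [W] into [S]. *)
    have hit (a : W) : exists s, rk a s /\ forall b, (b < a)%O -> ~ rk b s.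
      apply: contrapT => nos; apply: noa; exists a => s rs;
        apply: contrapT => nob.
      by apply: nos; exists s; split=> // b ltba rb; apply: nob; exists b.
    have [g gP] := choice hit; apply: (@no_injection_powerset S g) => a b eg.
    have [ra nra] := gP a; have [rb nrb] := gP b.
    have [ltab|ltba|//] := ltgtP (a : W) b.
      by case: (nrb a ltab); rewrite -eg.
    by case: (nra b ltba); rewrite eg.
  exists a => s [b]; elim/(well_founded_ind wfW): b s => b IH s rb.
  have [ltba|leab] := ltP b a; first by exists b.
  apply: aP; case: rb => H; split=> N NS NXY.
  have [n [c [ltcb rc]]] := H N NS NXY.
  have [c' ltc'a rc'] := IH c ltcb (N n.+1, N n) rc.
  by exists n, c'.
have [[b rb]|nob] := pselect (exists b : W, rk b (bot, top)).
  have [| | |zM|[c [_ Kc]]] := @rank_le_Kdim _ W wfW M b bot top M id rb.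
  - by [].
  - by [].
  - move=> U; split=> x; last by rewrite mem_top.
    by move=> /mem_bot ->; apply: rpred0.
  - by exists _, W, wfW, None.
  - by exists _, W, wfW, (Some c).
case: ndM; exists (fun X Y : submodClosed M =>
  {subset X <= Y} /\ ~ exists b : W, rk b (X, Y)); last first.
  by split=> // x _; rewrite mem_top.
move=> X Y [XY nrXY].
(* Otherwise the interval would have rank at most [a0]. *)
have [N [NS NXY nrN]] : exists N : nat -> submodClosed M,
   [/\ forall n, strict (N n.+1) (N n),
       forall n, {subset X <= N n} /\ {subset N n <= Y} &
       forall n, ~ exists b : W, rk b (N n.+1, N n)].
  apply: contrapT => noN; apply: nrXY; exists a0; split=> N NS NXY.
  apply: contrapT => non; apply: noN; exists N; split=> // n [b rb].
  have [c ltca rc] := a0P (N n.+1, N n) (ex_intro _ b rb).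
  by apply: non; exists n, c.
have [_ N0Y] := NXY 0%N; have [XN2 _] := NXY 2%N; have [XN1 N1Y] := NXY 1%N.
have [N10 [x xN0 xN1]] := NS 0%N; have [N21 _] := NS 1%N.
split; first by split=> //; exists x; [apply: N0Y | apply: contra xN1;
  apply: XN1].
(* [[X, N 1]] contains [[N 2, N 1]] and [[N 1, Y]] contains [[N 1, N 0]]. *)
exists (N 1%N); split; split=> // -[b rb].
  by case: (nrN 1%N); exists b; apply: rank_le_mono rb.
by case: (nrN 0%N); exists b; apply: rank_le_mono rb.
Qed.
End DenseKrull.

(** * Annihilators and uniform elements *)

Section RegularColon.
Variables (A : comNzRingType) (M : lmodType A).
Implicit Types P N I : submodClosed M.

Lemma colon_is_submod I (x : M) :
  is_submod (fun a : A^o => (a : A) *: x \in I).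
Proof.
split=> [|a b c bI cI]; first by rewrite scale0r rpred0.
by rewrite scalerDl rpredD // -[(a *: b) *: x]scalerA; apply: rpredZ bI.
Qed.
Definition colon I x : ideal A := submod_of (colon_is_submod I x).

Lemma mem_colon I x (a : A) : a \in colon I x <-> a *: x \in I.
Proof. exact: (submod_ofP (colon_is_submod I x) a). Qed.

(** The cyclic module [(I + A x) / I] is [A / (I : x)]. *)
Lemma dense_colon I x : dense I (adjoin I x) -> dense (colon I x) top.
Proof.
move=> dI; exists (fun X Y : ideal A => exists X' Y' : submodClosed M,
   [/\ {subset I <= X'}, {subset Y' <= adjoin I x}, dense X' Y',
   {subset X <= colon X' x} & {subset colon Y' x <= Y}]); last first.
  by exists I, (adjoin I x); split=> // y _; rewrite mem_top.
move=> X Y [X' [Y' [IX' Y'N d' XX' Y'Y]]].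
have [[X'Y' [y yY' yX']] [Z [dXZ dZY]]] := dense_split d'; split.
  split; first by move=> a /XX'/mem_colon/X'Y' aY; apply/Y'Y/mem_colon.
  have /mem_adjoin[a /IX' ya] := Y'N _ yY'; exists a.
    apply/Y'Y/mem_colon; rewrite -(subKr y (a *: x)); apply: submodB => //.
    exact: X'Y'.
  apply: contra yX' => /XX'/mem_colon aX.
  by rewrite -(subrK (a *: x) y) rpredD.
exists (colon Z x); split; [exists X', Z | exists Z, Y']; split=> // z.
  by move/(dense_sub dZY)/Y'N.
by move/IX'/(dense_sub dXZ).
Qed.

(** The cyclic module generated by [z] in [M / I] is uniform: any two of its
non-zero submodules meet. *)
Definition uniform_mod I (z : M) := forall a b : A,
  a *: z \notin I -> b *: z \notin I ->
  exists c d : A, c *: (a *: z) \notin I /\ c *: (a *: z) - d *: (b *: z) \in I.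

(** If no multiple of [z] is uniform, then [z] has two multiples [x] and [z']
that are independent modulo [I]; keep [x] and continue with [z']. *)
Lemma exists_uniform I :
  (forall x : nat -> M, ~ independent I x) -> (exists x, x \notin I) ->
  exists2 z, z \notin I & uniform_mod I z.
Proof.
move=> noind [z0 z0I]; apply: contrapT => nouni.
pose St := {z : M | z \notin I}.
have step (z : St) : exists ab : A * St,
    [/\ ab.1 *: sval z \notin I, exists b, sval ab.2 = b *: sval z &
     forall c d, c *: (ab.1 *: sval z) - d *: sval ab.2 \in I ->
     c *: (ab.1 *: sval z) \in I].
  case: z => z zI /=; apply: contrapT => noab; apply: nouni;
    exists z => // a b aI bI.
  apply: contrapT => nocd; apply: noab; exists (a,
    exist _ (b *: z) bI : St) => /=.
  split=> //; first by exists b.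
  move=> c d cd; apply: contrapT => /negP cI; apply: nocd; exists c, d.
  by split.
have [f fP] := choice step.
pose s n := iter n (fun s => (f s).2) (exist _ z0 z0I : St).
pose z n := sval (s n); pose a n := (f (s n)).1.
apply: (noind (fun n => a n *: z n)).
apply: (@independent_triangular _ _ _ _ (fun n => adjoin I (z n.+1))).
- by move=> n; case: (fP (s n)).
- by move=> n; apply: sub_adjoin.
- have zz m n : (n <= m)%N -> z m \in adjoin I (z n).
    move=> /subnK <-; elim: (m - n)%N => [|k IH]; first exact: mem_adjoin_gen.
    by have [_ [b zb] _] := fP (s (k + n)%N); rewrite addSn /z [s _]/= zb;
      apply: rpredZ IH.
  by move=> m n nm; apply: rpredZ; apply: zz.
- by move=> n c /mem_adjoin[d]; case: (fP (s n)) => _ _; apply.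
Qed.

End RegularColon.

(** * Arithmetical rings without idempotent essential ideals *)

Section Arithmetical.
Variable A : comNzRingType.
Implicit Types (I B L p q : ideal A) (x y u a b : A).

(** Elementwise form of the statement that all localizations at primes are
chain rings. *)
Definition locally_chain (R : comNzRingType) := forall x y : R,
  exists u : R,
    (exists a : R, u * x = a * y) /\ (exists b : R, (1 - u) * y = b * x).

Lemma regular_scale1 a : a *: (1 : A^o) = a.
Proof. exact: mulr1. Qed.

Lemma idealM I a x : x \in I -> a * x \in I.
Proof. exact: rpredZ. Qed.

Lemma idealD I x y : x \in I -> y \in I -> x + y \in I.
Proof. exact: rpredD. Qed.

Lemma ideal0 I : (0 : A) \in I.
Proof. exact: rpred0. Qed.

Lemma mem_principal (x z : A) :
  z \in adjoin (bot : ideal A) x <-> exists a, z = a * x.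
Proof.
split=> [/mem_adjoin[a /mem_bot/eqP]|[a ->]]; last by apply/mem_adjoin;
  exists a; rewrite subrr ideal0.
by rewrite subr_eq0 => /eqP ->; exists a.
Qed.

(** As [x = y + (x - y)], distributivity writes [x] as the sum of a common
multiple of [x] and [y] and a common multiple of [x] and [x - y]. If the latter
is [(x - y) b'], then [u = 1 - b'] works. *)
Lemma arithmetical_locally_chain : arithmetical A -> locally_chain A.
Proof.
move=> arithA x y; pose pr z := adjoin (bot : ideal A) z.
have prx z : z \in pr z by apply: mem_adjoin_gen.
have := arithA (pr x) (pr y) (pr (x - y)).
move=> /(congr1 (fun S : set A => S x)) E.
have : ideal_add ([set` pr x] `&` [set` pr y])
  ([set` pr x] `&` [set` pr (x - y)]) x.
  rewrite -E; split=> /=; first exact: prx.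
  by exists y; [exact: prx | exists (x - y);
    [exact: prx | rewrite addrC subrK]].
move=> [g [gx gy] [h [hx hxy] ghx]].
move: gx gy hx hxy => /mem_principal[a ga] /mem_principal[a' ga'].
move=> /mem_principal[b hb] /mem_principal[b' hb'].
exists (1 - b'); split; [exists (a' - b') | exists (b' - b)].
  have -> : (1 - b') * x = g + h - b' * x by rewrite ghx mulrBl mul1r.
  by rewrite ga' hb' mulrBr mulrBl addrA addrAC addrK.
by rewrite opprB addrCA subrr addr0 mulrBl -hb hb' mulrBr subKr.
Qed.

Definition prime_ideal p :=
  1 \notin p /\ forall x y, x * y \in p -> x \in p \/ y \in p.

Definition no_independent := forall L (x : nat -> A^o), ~ independent L x.

(** If every [t] in [B] were congruent modulo [I] to a sum of two products of
elements of [B], then the proper essential ideal [B / I] would be idempotent.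
*)
Definition no_idempotent := forall I B, {subset I <= B} -> 1 \notin B ->
  (forall y, y \notin I -> exists a, a * y \in B /\ a * y \notin I) ->
  exists2 t, t \in B & forall x y z w, x \in B -> y \in B -> z \in B ->
    w \in B -> t - (x * y + z * w) \notin I.

Hypotheses (chainA : locally_chain A).
Hypotheses (indA : no_independent) (idemA : no_idempotent).

(** If [x] and [y] are killed by [s] and [t], then a common multiple of [x] and
[y] is killed by [s + t]. *)
Lemma zero_divisors_is_submod I : uniform_mod I (1 : A^o) -> 1 \notin I ->
  is_submod (fun s : A^o => exists2 x : A, x \notin I & (s : A) * x \in I).
Proof.
move=> uI I1; split; first by exists 1; rewrite // mul0r; apply: ideal0.
move=> a s t [x xI sx] [y yI ty].
have [||c [d []]] := uI x y; rewrite ?regular_scale1 //.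
move=> cx cxdy; exists (c * x) => //.
have -> : (a *: s + t) * (c * x) = (a * c) * (s * x) + 
    (t * (c * x - d * y) + d * (t * y)).
  rewrite mulrDl mulrBr; congr +%R; last by rewrite [t * (d * _)]mulrCA subrK.
  by rewrite -!mulrA; congr *%R; rewrite mulrCA.
by do 2?apply: idealD; apply: idealM.
Qed.

(** For a uniform [z], the zero divisors modulo [J = (I : z)] form a prime [p].
If [p] is not [J], take [t] in [p] that is not congruent modulo [J] to a sum of
two products of elements of [p], and [x] outside [J] with [t x] in [J]. In the
localization at [p] every [r] in [p] is a multiple of [t], for otherwise [t]
would be [r] times an element of [p]; hence [r x] is in [J], so that [p] is the
annihilator of [x] modulo [J]. *)
Lemma exists_prime_annihilator I : 1 \notin I ->
  exists2 y, y \notin I &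
  exists2 p, prime_ideal p & forall a, a * y \in I <-> a \in p.
Proof.
move=> I1; have [|z zI uz] := @exists_uniform _ _ I (@indA I);
  first by exists (1 : A).
(* Passing to [(I : z)] replaces the uniform element by 1. *)
pose J := colon I z.
have memJ a : a \in J <-> a * z \in I by exact: mem_colon.
have J1 : 1 \notin J by apply/negP => /memJ; rewrite mul1r; apply/negP.
have uJ : uniform_mod J (1 : A^o).
  move=> a b; rewrite !regular_scale1 => aJ bJ.
  have [||c [d [cz cdz]]] := uz a b; try by apply/negP => /mem_colon;
    apply/negP.
  exists c, d; split.
    by apply: contra cz => /memJ; rewrite -mulrA.
  by apply/memJ; rewrite mulrBl -!mulrA.
pose p := submod_of (zero_divisors_is_submod uJ J1).
have memp s : s \in p <-> exists2 x, x \notin J & s * x \in J.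
  exact: submod_ofP.
have pP : prime_ideal p.
  split; first by apply/negP => /memp[x /negP xJ]; rewrite mul1r.
  move=> a b /memp[x xJ abx].
  have [bx|bx] := boolP (b * x \in J); first by right; apply/memp; exists x.
  by left; apply/memp; exists (b * x); rewrite // mulrA.
have Jp : {subset J <= p} by move=> a aJ; apply/memp; exists 1;
  rewrite // mulr1.
have [[t0 t0p t0J]|pJ] := pselect (exists2 t, t \in p & t \notin J); last first.
  exists z => //; exists p => // a; split=> [/memJ/Jp //|ap].
  by apply/memJ; apply: contrapT => /negP aJ; apply: pJ; exists a.
have [||t tp tpp] := idemA Jp; first by case: pP.
  move=> y yJ; have [||c [d []]] := uJ y t0;
    rewrite ?regular_scale1 // => cy cyt.
  exists c; split=> //; rewrite -(subrK (d * t0) (c * y)) idealD ?idealM //.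
  exact: Jp.
have /memp[x xJ tx] := tp.
exists (x * z); first by apply: contra xJ => /memJ.
exists p => // r; rewrite mulrA -memJ.
split=> [rx|rp]; first by apply/memp; exists x.
have [u [[a ura] [b utb]]] := chainA r t.
have unp s : s \notin p -> s * (r * x) \in J -> r * x \in J.
  by move=> sp srx; apply: contrapT => /negP rx; case/negP: sp; apply/memp;
    exists (r * x).
(* [u r] is a multiple of [t], and [(1 - u) t] is [b r]. *)
have [up|up] := boolP (u \in p); last first.
  by apply: (unp u up); rewrite mulrA ura -mulrA idealM.
have [bp|bp] := boolP (b \in p).
  have /negP[] := tpp u t b r up tp bp rp.
  by rewrite -utb mulrBl mul1r addrCA subrr addr0 subrr ideal0.
by apply: (unp b bp); rewrite mulrA -utb -mulrA idealM.
Qed.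

Lemma not_dense_above I :
  (forall p, prime_ideal p -> {subset I <= p} -> ~ dense p top) ->
  ~ dense I top.
Proof.
move=> ndp; apply: no_dense_chain => [L x _|P IP [x xP]]; first exact: indA.
have P1 : 1 \notin P by apply: contra xP => P1; rewrite -(mulr1 x) idealM.
have [y yP [p pP yp]] := exists_prime_annihilator P1; exists y => //.
move=> /dense_colon dy; apply: (ndp p pP).
  by move=> a aI; apply/yp; rewrite mulrC idealM // IP.
by apply: dense_mono dy => // a /yp aP; apply/mem_colon.
Qed.

(** For [t] in [p n] and [y] in [p n.+1] outside [p n], locally at [p n] [y]
divides [t], and the quotient is again in [p n]. So every element [t] of the
union [U] is a sum of two products, while [U] is essential above [p 0]. *)
Lemma prime_ascending_chain (p : nat -> ideal A) :
  (forall n, prime_ideal (p n)) -> ~ forall n, strict (p n) (p n.+1).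
Proof.
move=> pP pS; have pm n : {subset p n <= p n.+1} by case: (pS n).
pose U := submod_of (bigcup_is_submod pm).
have pU n : {subset p n <= U} by move=> x xp; apply/submod_ofP; exists n.
have [|||t /submod_ofP[n tn] tU] := @idemA (p 0%N) U.
- exact: pU.
- by apply/negP => /submod_ofP[n]; apply/negP; case: (pP n).
- move=> y yp; have [_ [t t1 t0]] := pS 0%N; exists t; split.
    by rewrite mulrC idealM // (pU 1%N).
  by apply/negP => /(pP 0%N).2[]; apply/negP.
have [_ [y y1 yn]] := pS n.
have [u [[a ua] [b ub]]] := chainA t y.
have u1 : 1 - u \in p n.
  have : (1 - u) * y \in p n by rewrite ub idealM.
  by case/(pP n).2 => // yp; rewrite yp in yn.
have an : a \in p n.
  have : a * y \in p n by rewrite -ua idealM.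
  by case/(pP n).2 => // yp; rewrite yp in yn.
have /negP[] := tU a y (1 - u) t (pU _ _ an) (pU _ _ y1) (pU _ _ u1) (pU _ _
  tn).
by rewrite -ua -mulrDl [u + _]addrC subrK mul1r subrr ideal0.
Qed.

(** A prime [q] maximal among those with dense factor ring would have a dense
[[Z, A]] with [Z] strictly above [q], but no prime above [Z] has a dense factor
ring. *)
Theorem arithmetical_not_dense : ~ dense (bot : ideal A) top.
Proof.
suff ndp p : prime_ideal p -> ~ dense p top.
  by apply: not_dense_above => p pP _; apply: ndp.
move=> pP dp; pose St := {p : ideal A | prime_ideal p /\ dense p top}.
have [[q [qP dq] qmax]|nomax] := pselect (exists2 q : ideal A,
    prime_ideal q /\ dense q top &
    forall r, prime_ideal r -> dense r top -> ~ strict q r).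
  have [_ [Z [dqZ]]] := dense_split dq; apply: not_dense_above => r rP Zr dr.
  apply: (qmax r) => //; have [qZ [x xZ xq]] := dense_strict dqZ.
  by split=> [y /qZ/Zr //|]; exists x => //; apply: Zr.
have step (q : St) : exists r : St, strict (sval q) (sval r).
  case: q => q qP /=; apply: contrapT => nor; apply: nomax;
    exists q => // r rP dr qr.
  by apply: nor; exists (exist _ r (conj rP dr)).
have [f fP] := choice step.
pose s n := iter n f (exist _ p (conj pP dp) : St).
apply: (@prime_ascending_chain (fun n => sval (s n))) => [n|n]; last exact: fP.
by case: (svalP (s n)).
Qed.

End Arithmetical.

(** * Infinite direct sums give dense intervals *)

Section IndependentDense.
Variables (A : comNzRingType) (M : lmodType A) (L : submodClosed M).
Variable x : nat -> M.

Definition combination (n : nat) (c : nat -> A) := \sum_(0 <= i < n) c i *: x i.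

Lemma combination_widen m n c :
  (m <= n)%N -> (forall i, (m <= i)%N -> c i = 0) ->
  combination n c = combination m c.
Proof.
move=> mn c0; rewrite /combination (big_cat_nat (n := m)) //=.
rewrite [X in _ + X]big1_seq ?addr0 //.
by move=> i; rewrite mem_index_iota => /= /andP[mi _]; rewrite c0 // scale0r.
Qed.

Lemma span_is_submod (S : nat -> Prop) : is_submod (fun y => exists n c,
  [/\ forall i, ~ S i -> c i = 0, forall i, (n <= i)%N -> c i = 0
    & y - combination n c \in L]).
Proof.
split=> [|a y z [m [c [cS cm yc]]] [n [d [dS dn zd]]]].
  exists 0%N, (fun=> 0); split=> //.
  by rewrite /combination big_geq // subr0 rpred0.
exists (maxn m n), (fun i => a * c i + d i); split.
- by move=> i Si; rewrite cS // dS // mulr0 addr0.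
- by move=> i; rewrite geq_max => /andP[mi ni]; rewrite cm // dn // mulr0 addr0.
have -> : combination (maxn m n) (fun i => a * c i + d i) =
    a *: combination m c + combination n d.
  rewrite -(combination_widen (leq_maxl m n) cm).
  rewrite -(combination_widen (leq_maxr m n) dn).
  rewrite /combination scaler_sumr -big_split /=; apply: eq_bigr => i _.
  by rewrite scalerDl scalerA.
by rewrite opprD addrACA -scalerBr rpredD ?rpredZ.
Qed.

(** The submodule generated by [L] and by the [x i] with [i] in [S]. *)
Definition span S := submod_of (span_is_submod S).

Lemma span_mono (S T : nat -> Prop) :
  (forall i, S i -> T i) -> {subset span S <= span T}.
Proof.
move=> ST y /submod_ofP[n [c [cS cn yc]]]; apply/submod_ofP; exists n, c;
  split=> // i.
by move=> /(contra_not (ST i))/cS.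
Qed.

Lemma span_gen (S : nat -> Prop) k : S k -> x k \in span S.
Proof.
move=> Sk; apply/submod_ofP; exists k.+1, (fun i => (i == k)%:R); split.
- by move=> i; case: eqP => // ->.
- by move=> i; rewrite ltnNge; case: eqP => // ->; rewrite leqnn.
rewrite /combination big_nat_recr //= eqxx scale1r big1_seq ?add0r ?subrr
  ?rpred0 //.
by move=> i; rewrite mem_index_iota /= => ik; rewrite ltn_eqF // scale0r.
Qed.

Lemma span_notin (S : nat -> Prop) k :
  independent L x -> ~ S k -> x k \notin span S.
Proof.
move=> [xL ind] Sk; apply/negP => /submod_ofP[n [c [cS cn xc]]].
pose d i := (i == k)%:R - c i.
have e : combination (maxn k.+1 n) d = x k - combination n c.
  rewrite -(combination_widen (leq_maxr k.+1 n) cn) /combination.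
  rewrite (eq_bigr (fun i => (i == k)%:R *: x i - c i *: x i)); last first.
    by move=> i _; rewrite scalerBl.
  rewrite sumrB; congr (_ - _).
  rewrite (bigD1_seq k) ?iota_uniq ?mem_index_iota ?leq_max ?ltnSn //=.
  by rewrite eqxx scale1r big1 ?addr0 // => i /negbTE ->; rewrite scale0r.
rewrite -e in xc; have := ind _ d (iota_uniq _ _) xc k.
rewrite mem_index_iota leq_max ltnSn /d eqxx cS // subr0 scale1r => /(_ isT).
exact/negP.
Qed.

(** Enumerate the rationals: the sets of indices of rationals below [q], for
[q] between 0 and 1, form a dense chain, and their spans are distinct. *)
Lemma independent_dense : independent L x -> dense L top.
Proof.
move=> ind; pose S (q : rat) i := exists2 r : rat, (r < q)%R & pickle r = i.
have Smono (q r : rat) : (q < r)%R -> strict (span (S q)) (span (S r)).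
  move=> qr; split.
    by apply: span_mono => i [t tq <-]; exists t => //; apply: lt_trans qr.
  exists (x (pickle q)); first by apply: span_gen; exists q.
  apply: span_notin => // -[t tq /(pcan_inj pickleK) eqt].
  by rewrite eqt ltxx in tq.
have LS (q : rat) : {subset L <= span (S q)}.
  move=> y yL; apply/submod_ofP; exists 0%N, (fun=> 0); split=> //.
  by rewrite /combination big_geq // subr0.
apply: (@dense_mono _ _ (span (S 0)) (span (S 1))) => //.
  by move=> y _; rewrite mem_top.
exists (fun X Y => exists q r : rat,
  [/\ (q < r)%R, X = span (S q) & Y = span (S r)]).
  move=> _ _ [q [r [qr -> ->]]]; split; first exact: Smono.
  have [qm mr] := midf_lt qr.
  by exists (span (S ((q + r) / 2))); split;
    [exists q, ((q + r) / 2) | exists ((q + r) / 2), r].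
by exists 0, 1.
Qed.
End IndependentDense.

Section FiniteDimension.
Variables (A : comNzRingType).

Lemma infinite_direct_independent (M : lmodType A) : ~ finite_dimensional M ->
  exists x : nat -> M, independent bot x.
Proof.
move=> /contrapT[I [N [infI nzN dirN]]].
have [j j_inj] : exists j : nat -> I, injective j.
  have /card_leP/injfunPex[f _ f_inj] := (infiniteP _).1 infI.
  exists (fun n => val (f (exist _ n (in_setT n)))) => m n /val_inj/f_inj.
  by move=> /(_ (in_setT _) (in_setT _))/(congr1 val).
have /choice[x xP] : forall n, exists x, x \in N (j n) /\ x != 0.
  move=> n; apply: contrapT => nox; apply: (nzN (j n)); apply/seteqP;
    split=> y /=.
    move=> yN; apply: contrapT => /eqP y0; apply: nox; by exists y.
  by move=> ->; apply: rpred0.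
exists x; split.
  by move=> n; apply/negP => /mem_bot x0; have [_] := xP n; rewrite x0 eqxx.
move=> s c us /mem_bot sum0 i si; apply/mem_bot.
(* The members of the family outside the range of [j] contribute 0. *)
pose y k := if pselect (exists n, j n = k) is left e
  then c (projT1 (cid e)) *: x (projT1 (cid e)) else 0.
have yj n : y (j n) = c n *: x n.
  rewrite /y; case: pselect => [e|[]]; last by exists n.
  by case: cid => m /= /j_inj ->.
rewrite -yj; apply: (dirN [seq j n | n <- s]).
- by rewrite map_inj_uniq.
- move=> k; rewrite /y; case: pselect => [e|_]; last exact: rpred0.
  by case: cid => m /= <-; rewrite rpredZ //; case: (xP m).
- by rewrite big_map -[RHS]sum0; apply: eq_bigr => n _; rewrite yj.
- exact: map_f.
Qed.
End FiniteDimension.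

(** * Idempotent essential ideals give dense intervals *)

Section IdempotentIdeal.
Variables (R : comNzRingType) (B : ideal R).
Hypothesis chainR : locally_chain R.
Implicit Types (I m : ideal R) (x y z a b : R).

Definition maximal_ideal m :=
  1 \notin m /\ forall x, x \notin m -> exists a, 1 - a * x \in m.

Lemma exists_maximal_ideal I : 1 \notin I ->
  exists2 m, maximal_ideal m & {subset I <= m}.
Proof.
move=> I1; pose T := {J : ideal R | {subset I <= J} /\ 1 \notin J}.
have II : {subset I <= I} /\ 1 \notin I by split.
pose t0 : T := exist _ I II.
have [|||[m [Im m1]] mmax] := @ZL_preorder T t0 (fun J K =>
  `[< {subset sval J <= sval K} >]).
- by move=> J; apply/asboolP.
- by move=> J K L /asboolP KJ /asboolP JL; apply/asboolP => x /KJ/JL.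
- move=> C Ctot; have [[J0 CJ0]|noC] := pselect (exists J, C J); last first.
    by exists t0 => J CJ; case: noC; exists J.
  have U_is : is_submod (fun x : R^o => exists2 J : T, C J & x \in sval J).
    split; first by exists J0 => //; apply: rpred0.
    move=> a x y [J CJ xJ] [K CK yK].
    case: (Ctot J K CJ CK) => /asboolP sub; [exists K | exists J] => //.
      by apply: rpredD => //; apply: rpredZ; apply: sub.
    by apply: rpredD; [apply: rpredZ | apply: sub].
  have UP : {subset I <= submod_of U_is} /\ 1 \notin submod_of U_is.
    split; first by move=> x xI; apply/submod_ofP; exists J0 => //;
      apply: (svalP J0).1.
    by apply/negP => /submod_ofP[J _]; apply/negP; apply: (svalP J).2.
  exists (exist _ (submod_of U_is) UP : T) => J CJ; apply/asboolP => x xJ;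
    apply/submod_ofP.
  by exists J.
exists m => //; split=> // x xm; apply: contrapT => noa.
have mx1 : {subset I <= adjoin m x} /\ 1 \notin adjoin m x.
  split; first by move=> y /Im; apply: sub_adjoin.
  by apply/negP => /mem_adjoin[a am]; apply: noa; exists a.
have /asboolP sub := mmax (exist _ (adjoin m x) mx1 : T)
  (introT (asboolP _) (@sub_adjoin _ _ m x)).
by case/negP: xm; apply: sub; apply: mem_adjoin_gen.
Qed.

Lemma maximal_ideal_mul m x y :
  maximal_ideal m -> x \notin m -> y \notin m -> x * y \notin m.
Proof.
move=> [m1 mmax] /mmax[a am] ym; apply: contra ym => xym.
have -> : y = y * (1 - a * x) + a * (x * y).
  by rewrite mulrBr mulr1 [y * (a * x)]mulrC -mulrA subrK.
by apply: idealD; apply: idealM.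
Qed.

Section Saturation.
Variable m : ideal R.
Hypothesis mmax : maximal_ideal m.

Lemma saturation_is_submod y : is_submod (fun a : R^o =>
  exists s w : R, s \notin m /\ s * a = w * y).
Proof.
split; first by exists 1, 0; rewrite mulr0 mul0r; split=> //; case: mmax.
move=> c a b [s [v [sm sa]]] [t [w [tm tb]]].
exists (s * t), (c * t * v + s * w); split; first exact: maximal_ideal_mul.
rewrite mulrDl -!mulrA -sa -tb [RHS](_ :
  _ = c * (t * (s * a)) + s * (t * b)) //.
by rewrite mulrDr mulrDr [t * (s * a)]mulrCA [c * (s * _)]mulrCA [c * (t *
  a)]mulrCA.
Qed.

(** The contraction to [R] of the ideal generated by [y] in the localization at
[m]. *)
Definition sat y : ideal R := submod_of (saturation_is_submod y).

Lemma mem_sat y a : a \in sat y <-> exists s w : R, s \notin m /\ s * a = w * y.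
Proof. exact: (submod_ofP (saturation_is_submod y) a). Qed.

Lemma sat_gen y : y \in sat y.
Proof. by apply/mem_sat; exists 1, 1; split=> //; case: mmax. Qed.

Lemma sat_sub x y : x \in sat y -> {subset sat x <= sat y}.
Proof.
move=> /mem_sat[s [v [sm sx]]] a /mem_sat[t [w [tm ta]]]; apply/mem_sat.
exists (s * t), (w * v); split; first exact: maximal_ideal_mul.
by rewrite -mulrA ta mulrCA sx mulrA.
Qed.

Lemma sat_total x y : x \in sat y \/ y \in sat x.
Proof.
have [u [[a ua] [b ub]]] := chainR x y.
have [um|um] := boolP (u \in m).
  right; apply/mem_sat; exists (1 - u), b; split=> //.
  by apply/negP => um1; case/negP: mmax.1; rewrite -(subrK u 1) idealD.
by left; apply/mem_sat; exists u, a.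
Qed.

(** In a chain ring one member of a finite non-empty set divides all the
others. *)
Lemma finite_sat (s : seq R) : {subset s <= B} ->
  exists2 e, e \in B & {subset s <= sat e}.
Proof.
elim: s => [|x s IH] sB; first by exists 0; rewrite ?ideal0.
have [|e eB es] := IH; first by move=> y ys; apply: sB; rewrite inE ys orbT.
have xB : x \in B by apply: sB; rewrite inE eqxx.
have [xe|ex] := sat_total x e; [exists e | exists x] => // y.
  by rewrite inE => /predU1P[-> //|/es].
by rewrite inE => /predU1P[->|/es/(sat_sub ex) //]; apply: sat_gen.
Qed.

(** Locally all factors in an expression of [z] as a sum of products are
multiples of a single [e]. *)
Lemma idempotent_factor z : idempotent_ideal B -> z \in B ->
  exists s c e, [/\ s \notin m, c \in B, e \in B & s * z = c * e].
Proof.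
move=> idB zB; have : ideal_mul [set` B] [set` B] z by rewrite -idB.
move=> [n [x [y [xB yB ->]]]].
have [|e eB es] := @finite_sat [seq x i | i <- enum 'I_n].
  by move=> _ /mapP[i _ ->]; apply: xB.
have T_is : is_submod (fun a : R^o =>
    exists s c : R, [/\ s \notin m, c \in B & s * a = c * e]).
  split; first by exists 1, 0; rewrite mulr0 mul0r ideal0; split=> //;
    case: mmax.
  move=> a b c [s [v [sm vB sb]]] [t [w [tm wB tc]]].
  exists (s * t), (a * t * v + s * w); split; first exact: maximal_ideal_mul.
    by apply: idealD => //; apply: idealM.
  rewrite mulrDl -!mulrA -sb -tc [RHS](_ :
    _ = a * (t * (s * b)) + s * (t * c)) //.
  by rewrite mulrDr mulrDr [t * (s * b)]mulrCA [a * (s * _)]mulrCA [a * (t *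
    b)]mulrCA.
have : \sum_i x i * y i \in submod_of T_is.
  apply: (@rpred_sum R^o) => i _; apply/submod_ofP.
  have /mem_sat[s [w [sm sx]]] : x i \in sat e by apply: es;
    rewrite map_f ?mem_enum.
  exists s, (w * y i); split=> //; first exact: (idealM _ (yB i)).
  by rewrite mulrA sx mulrAC.
by move=> /submod_ofP[s [c [sm cB sc]]]; exists s, c, e.
Qed.

(** Consider the intervals from the saturation of [y z] to that of [y], where
[z] is in [B] and [y z] is locally non-zero. They are proper because [z] is not
a local unit, and locally [z = c e] with [c] and [e] in [B], so [y e] splits
them. *)
Lemma idempotent_dense z : idempotent_ideal B -> {subset B <= m} -> z \in B ->
  (forall s, s * z = 0 -> s \in m) -> dense (bot : ideal R) top.
Proof.
move=> idB Bm zB zm.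
have sat0 a : a \in sat 0 <-> exists2 s, s \notin m & s * a = 0.
  split=> [/mem_sat[s [w [sm]]]|[s sm sa]]; first by rewrite mulr0; exists s.
  by apply/mem_sat; exists s, 0; rewrite mulr0.
exists (fun X Y : ideal R => exists y z, [/\ {subset X <= sat (y * z)},
    {subset sat y <= Y}, z \in B & y * z \notin sat 0]); last first.
  exists 1, z; split=> //; first by move=> x /mem_bot ->; apply: rpred0.
    by move=> x _; rewrite mem_top.
  rewrite mul1r; apply/negP => /sat0[s sm sz].
  by rewrite (zm s sz) in sm.
move=> X Y [y [{zB zm}z [XS SY zB yz0]]].
have sub : {subset sat (y * z) <= sat y}.
  apply: sat_sub; apply/mem_sat; exists 1, z; rewrite mul1r mulrC.
  by split=> //; case: mmax.
split.
  split; first by move=> a /XS/sub/SY.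
  exists y; first exact/SY/sat_gen.
  apply: contra yz0 => /XS/mem_sat[s [w [sm sy]]]; apply/sat0.
  exists (s - w * z); last by rewrite mulrA mulrBl sy -[w * z * y]mulrA [z *
    y]mulrC subrr mul0r.
  by apply: contra sm => swm; rewrite -(subrK (w * z) s) idealD // idealM // Bm.
have [s [c [e [sm cB eB sz]]]] := idempotent_factor idB zB.
have ye0 : y * e * c \notin sat 0.
  apply: contra yz0 => /sat0[t tm tz]; apply/sat0; exists (t * s).
    exact: maximal_ideal_mul.
  by rewrite -mulrA [s * (y * z)]mulrCA sz [c * e]mulrC [y * (e * c)]mulrA.
exists (sat (y * e)); split.
  exists (y * e), c; split=> // a /XS/mem_sat[t [w [tm ta]]]; apply/mem_sat.
  exists (s * t), w; split; first exact: maximal_ideal_mul.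
  by rewrite -[s * t * a]mulrA ta mulrCA [s * (y * z)]mulrCA sz [c * e]mulrC [y
    * (e * c)]mulrA.
exists y, e; split=> //; apply: contra ye0 => /sat0[t tm tz]; apply/sat0.
by exists t; rewrite // mulrA tz mul0r.
Qed.

End Saturation.

(** The ideal [B] contains elements [b n] with [b n = b n * b n.+1], where each
[b n.+1] also fixes some [w n] in [B] killed by [b n]. Then [b n.+1] fixes [w
n] and kills all later [w m], which separates them. *)
Lemma pure_independent :
  (forall z, z \in B -> exists2 b, b \in B & z = z * b) ->
  1 \notin B -> essential_submod B ->
  exists x : nat -> R^o, independent (bot : ideal R) x.
Proof.
move=> pureB B1 essB.
have pure2 x y : x \in B -> y \in B -> exists b, [/\ b \in B,
  x = x * b & y = y * b].
  move=> /pureB[b bB xb] /pureB[c cB yc]; exists (b + c - b * c).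
  split; first by apply: submodB; [apply: idealD | apply: idealM].
    by rewrite mulrBr mulrDr mulrA -xb addrK.
  by rewrite mulrBr mulrDr [b * c]mulrC mulrA -yc [y * b + _]addrC addrK.
pose St := {b : R | b \in B}.
have step (b : St) : exists wb : R * St, [/\ wb.1 != 0, wb.1 * sval b = 0,
    wb.1 * sval wb.2 = wb.1 & sval b * sval wb.2 = sval b].
  (* [1 - c] kills [b], and is not zero because [B] is proper. *)
  case: b => b bB /=; have [c cB bc] := pureB b bB.
  have [w wB [a wa w0]] : exists2 w, w \in B & exists2 a,
    w = a * (1 - c) & w != 0.
    apply: contrapT => now; apply: (essB (adjoin (bot : ideal R) (1 - c))).
      move=> z; have : [set` adjoin (bot : ideal R) (1 - c)] (1 - c) by apply:
        mem_adjoin_gen.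
      by rewrite z => /eqP; rewrite subr_eq0 => /eqP c1; rewrite c1 cB in B1.
    apply/seteqP; split=> w; last first.
      by move=> w0; rewrite (w0 : w = 0); split; exact: (ideal0 _).
    move=> [wB /mem_principal[a wa]]; apply: contrapT => /eqP w0.
    by apply: now; exists w => //; exists a.
  have [b' [b'B bb' wb']] := pure2 b w bB wB.
  exists (w, exist _ b' b'B) => /=; split=> //.
  by rewrite wa -mulrA mulrBl mul1r [c * b]mulrC -bc subrr mulr0.
have [f fP] := choice step.
pose s n := iter n (fun s => (f s).2) (exist _ 0 (ideal0 B) : St).
pose b n := sval (s n); pose w n := (f (s n)).1; exists w.
have bb (m n : nat) : (m < n)%N -> b m * b n = b m.
  elim: n => // n IH; rewrite ltnS leq_eqVlt => /predU1P[->|mn].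
    by case: (fP (s n)).
  by rewrite -{1}(IH mn) -mulrA; case: (fP (s n)) => _ _ _;
    rewrite -/(b n) -/(b n.+1) => ->; apply: IH.
apply: (@independent_triangular _ _ _ _ (fun n => colon (bot :
  ideal R) (b n.+1))).
- by move=> n; apply/negP => /mem_bot; case: (fP (s n)) => /eqP.
- by move=> n x /mem_bot ->; apply: rpred0.
- move=> m n nm; apply/mem_colon/mem_bot; change (w m * b n.+1 = 0).
  have wb : w m * b m = 0 by case: (fP (s m)).
  move: nm; rewrite leq_eqVlt => /predU1P[-> //|nm].
  have := congr1 ( *%R (w m)) (bb _ _ nm).
  by rewrite mulrCA wb mulr0.
- move=> n a /mem_colon/mem_bot awb; apply/mem_bot.
  have <- : w n * b n.+1 = w n by case: (fP (s n)).
  by rewrite -awb; apply: mulrA.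
Qed.

(** If [z] is not of the form [z b] with [b] in [B], then the ideal generated
by [B] and the annihilator of [z] is proper, and [z] does not vanish in the
localization at a maximal ideal above it. *)
Theorem essential_idempotent_dense : idempotent_ideal B -> proper_submod B ->
  essential_submod B -> dense (bot : ideal R) top.
Proof.
move=> idB prB essB.
have B1 : 1 \notin B.
  apply/negP => B1; apply: prB; apply/seteqP; split=> // x _ /=.
  by rewrite -(mulr1 x) idealM.
have [pureB|/existsNP[z /not_implyP[zB nob]]] :=
    pselect (forall z, z \in B -> exists2 b, b \in B & z = z * b).
  by have [x] := pure_independent pureB B1 essB; apply: independent_dense.
have K_is : is_submod (fun a : R^o => exists2 b,
  b \in B & ((a : R) - b) * z = 0).
  split; first by exists 0; rewrite ?ideal0 // subrr mul0r.
  move=> c a a' [b bB ab] [b' b'B ab']; exists (c * b + b').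
    by apply: idealD => //; apply: idealM.
  rewrite [X in X * z](_ : _ = c * (a - b) + (a' - b')).
    by rewrite mulrDl -mulrA ab ab' mulr0 addr0.
  by rewrite opprD addrACA mulrBr.
have K1 : 1 \notin submod_of K_is.
  apply/negP => /submod_ofP[b bB]; rewrite mulrBl mul1r => /eqP.
  by rewrite subr_eq0 mulrC => /eqP zb; apply: nob; exists b.
have [m mmax Km] := exists_maximal_ideal K1.
apply: (idempotent_dense mmax idB _ zB) => [b bB|s sz]; apply/Km/submod_ofP.
  by exists b; rewrite // subrr mul0r.
by exists 0; rewrite ?ideal0 // subr0.
Qed.
End IdempotentIdeal.

(** * Factor rings *)

Section FactorRing.
Variables (A : comNzRingType) (I : idealr A).
Local Notation R := {ideal_quot I}.
Local Open Scope quotient_scope.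
Implicit Types x y : A.

Definition cls (x : A) : R := \pi_R x.

Lemma cls_eq x y : cls x = cls y <-> x - y \in I.
Proof. by rewrite Quotient.idealrBE; split=> [e|/eqP //]; apply/eqP. Qed.

Lemma cls_eq0 x : cls x = 0 <-> x \in I.
Proof.
by rewrite -(rmorph0 \pi_R) -[in X in _ <-> X](subr0 x); apply: cls_eq.
Qed.

Lemma clsD x y : cls (x + y) = cls x + cls y. Proof. exact: rmorphD. Qed.
Lemma clsB x y : cls (x - y) = cls x - cls y. Proof. exact: rmorphB. Qed.
Lemma clsM x y : cls (x * y) = cls x * cls y. Proof. exact: rmorphM. Qed.
Lemma cls0 : cls 0 = 0. Proof. exact: rmorph0. Qed.
Lemma cls1 : cls 1 = 1. Proof. exact: rmorph1. Qed.
Lemma cls_surj (q : R) : exists x, q = cls x.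
Proof. by exists (repr q); rewrite /cls reprK. Qed.

Lemma locally_chain_factor : locally_chain A -> locally_chain R.
Proof.
move=> chainA q r; have [x ->] := cls_surj q; have [y ->] := cls_surj r.
have [u [[a ua] [b ub]]] := chainA x y; exists (cls u); split.
  by exists (cls a); rewrite -!clsM ua.
by exists (cls b); rewrite -cls1 -clsB -!clsM ub.
Qed.

Lemma cls_preimage_is_submod (Q : ideal R) :
  is_submod (fun x : A^o => cls x \in Q).
Proof.
split=> [|a x y xQ yQ]; first by rewrite cls0 ideal0.
by change (cls (a * x + y) \in Q); rewrite clsD clsM idealD ?idealM.
Qed.
Definition cls_preimage Q : ideal A := submod_of (cls_preimage_is_submod Q).

Lemma mem_cls_preimage Q x : x \in cls_preimage Q <-> cls x \in Q.
Proof. exact: (submod_ofP (cls_preimage_is_submod Q) x). Qed.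

Lemma cls_image_is_submod (X : ideal A) :
  is_submod (fun q : R^o => exists2 x, x \in X & q = cls x).
Proof.
split=> [|q _ _ [x xX ->] [y yX ->]].
  by exists 0; rewrite ?ideal0 // cls0.
have [a ->] := cls_surj q; exists (a * x + y); last by rewrite clsD clsM.
by rewrite idealD ?idealM.
Qed.
Definition cls_image X : ideal R := submod_of (cls_image_is_submod X).

Lemma mem_cls_image X q : q \in cls_image X <-> exists2 x, x \in X & q = cls x.
Proof. exact: (submod_ofP (cls_image_is_submod X) q). Qed.

Lemma dense_factor_ring :
  dense (bot : ideal R) top -> dense (bot : ideal A) top.
Proof.
move=> dR; exists (fun X Y : ideal A => exists X' Y' : ideal R, [/\ dense X' Y',
  {subset X <= cls_preimage X'} & {subset cls_preimage Y' <= Y}]); last first.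
  exists bot, top; split=> // x; last by rewrite mem_top.
  by move=> /mem_bot ->; apply: rpred0.
move=> X Y [X' [Y' [d' XX Y'Y]]].
have [[XY' [q qY qX]] [Z [dXZ dZY]]] := dense_split d'.
have [x qx] := cls_surj q; split.
  split; first by move=> y /XX/mem_cls_preimage/XY'/mem_cls_preimage/Y'Y.
  exists x; first by apply/Y'Y/mem_cls_preimage; rewrite -qx.
  by apply: contra qX => /XX/mem_cls_preimage; rewrite -qx.
by exists (cls_preimage Z); split; [exists X', Z | exists Z, Y']; split.
Qed.

Lemma independent_not_finite_dimensional (L : ideal A) (x : nat -> A^o) :
  (forall y, y \in L <-> y \in I) -> independent L x ->
    ~ ring_finite_dimensional R.
Proof.
move=> LI [xL ind]; apply.
exists nat, (fun n => adjoin (bot : ideal R) (cls (x n))); split.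
- exact: infinite_nat.
- move=> n zN; have /negP := xL n; apply; apply/LI/cls_eq0.
  have : [set` adjoin (bot : ideal R) (cls (x n))] (cls (x n)) by apply:
    mem_adjoin_gen.
  by rewrite zN.
move=> s y us yN sum0 i si.
have /choice[c cP] n : exists c, y n = cls (c * x n).
  have /mem_principal[q ->] := yN n; have [c ->] := cls_surj q.
  by exists c; rewrite clsM.
rewrite cP; apply/cls_eq0/LI; apply: (ind s c us) => //.
apply/LI/cls_eq0; rewrite -[RHS]sum0 /cls.
have -> : \sum_(i <- s) y i = \sum_(i <- s) cls (c i * x i) by apply: eq_bigr.
exact: rmorph_sum.
Qed.

Lemma idempotent_cls_image (L B : ideal A) :
  (forall y, y \in L <-> y \in I) -> 1 \notin B -> {subset L <= B} ->
  (forall y, y \notin L -> exists a, a * y \in B /\ a * y \notin L) ->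
  (forall t, t \in B -> exists x y z w, [/\ x \in B, y \in B, z \in B, w \in B
     & t - (x * y + z * w) \in L]) ->
  exists Q : ideal R, 
    [/\ idempotent_ideal Q, proper_submod Q & essential_submod Q].
Proof.
move=> LI B1 LB essB idB; exists (cls_image B).
have imB x : cls x \in cls_image B -> x \in B.
  move=> /mem_cls_image[y yB /cls_eq/LI/LB xy].
  by rewrite -(subrK y x) idealD.
have Bim x : x \in B -> cls x \in cls_image B.
  by move=> xB; apply/mem_cls_image; exists x.
split.
- apply/seteqP; split=> q /=.
    move=> /mem_cls_image[t tB ->].
    have [x [y [z [w [xB yB zB wB /LI/cls_eq ->]]]]] := idB t tB.
    exists 2%N, (fun i => cls (if i == ord0 then x else z)),
      (fun i => cls (if i == ord0 then y else w)); split.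
    + by move=> i; case: ifP => _; apply: Bim.
    + by move=> i; case: ifP => _; apply: Bim.
    + by rewrite big_ord_recl big_ord1 /= clsD !clsM.
  move=> [n [x [y [xB yB ->]]]].
  suff : \sum_i x i * y i \in cls_image B by [].
  by apply: (@rpred_sum R^o) => i _; apply: idealM; apply: yB.
- move=> full; case/negP: B1; apply: imB.
  by have : [set: R^o] (cls 1) by []; rewrite -full.
- move=> Y nzY BY; apply: nzY; apply/seteqP; split=> q /=; last first.
    by move=> ->; apply: (ideal0 Y).
  have [x ->] := cls_surj q => xY; apply/cls_eq0/LI.
  apply: contrapT => /negP /essB[a [axB axL]].
  have : ([set` cls_image B] `&` [set` Y]) (cls (a * x)).
    by split; [apply: Bim | rewrite /= clsM; apply: (idealM (cls a) xY)].
  by rewrite BY => /cls_eq0/LI; apply/negP.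
Qed.
End FactorRing.

Section IdealrOf.
Variables (A : comNzRingType) (L : ideal A).
Hypothesis L1 : 1 \notin L.

Lemma ideal_idealr_closed : idealr_closed (fun x : A => x \in L).
Proof.
split; [exact: ideal0 | exact: L1 | move=> a x y xL yL].
by change (a * x + y \in L); rewrite idealD ?idealM.
Qed.

Definition idealr_of : idealr A :=
  HB.pack (fun x : A => x \in L)
    (isIdealr.Build A (fun x : A => x \in L) ideal_idealr_closed).

Lemma mem_idealr_of x : x \in L <-> x \in idealr_of.
Proof. by []. Qed.
End IdealrOf.

(* The factor rings of [A] are the rings [{ideal_quot I}], for [I] ranging over
   the proper ideals ([idealr A]) of [A]. *)
Theorem theorem1 (A : comNzRingType) (arithA : arithmetical A) :
  ring_has_Krull_dimension A <->
  (forall I : idealr A,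
     ring_finite_dimensional {ideal_quot I} /\
     ~ (exists B : ideal {ideal_quot I},
          [/\ idempotent_ideal B, proper_submod B & essential_submod B])).
Proof.
have chainA := arithmetical_locally_chain arithA.
split=> [/has_Krull_dimension_not_dense ndA I | condA].
  have ndR : ~ dense (bot : ideal {ideal_quot I}) top.
    by move=> /dense_factor_ring.
  split.
    apply: contrapT => /infinite_direct_independent[x].
    by move/independent_dense.
  move=> [B [idB prB essB]]; apply: ndR.
  exact: essential_idempotent_dense (locally_chain_factor chainA) idB prB essB.
apply: not_dense_has_Krull_dimension; apply: arithmetical_not_dense => //.
  move=> L x indx; have L1 : 1 \notin L.
    by apply: contra (indx.1 0%N) => L1; rewrite -(mulr1 (x 0%N));
      apply: idealM.
  have [fin _] := condA (idealr_of L1).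
  exact: (@independent_not_finite_dimensional A (idealr_of L1) L x _ indx fin).
move=> L B LB B1 essB; apply: contrapT => noT.
have L1 : 1 \notin L by apply: contra B1; apply: LB.
have [_] := condA (idealr_of L1); apply.
apply: (@idempotent_cls_image A (idealr_of L1) L B (mem_idealr_of L1) B1 LB
  essB) => t tB.
apply: contrapT => nox; apply: noT; exists t => // x y z w xB yB zB wB.
by apply/negP => tL; apply: nox; exists x, y, z, w.
Qed.
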